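(* Let $X(t)_{t\ge 0}$ be a time homogeneous Markov process (in discrete or continuous time) with càdlàg paths and the strong Markov property. Assume $X(t)_{t\ge0}$ has a quasistationary distribution (QSD) $\rho$ in an open set $U$, and that $T=\inf\{t\ge 0: X(t)\notin U\}$ is finite almost surely. Let $(X_m(t)_{t\ge0},T_m)_{m\ge1}$ be copies of $(X(t)_{t\ge0},T)$ such that: (a) conditional on $X_m(0)$, $X_m(t)_{t\ge0}$ is independent of $(X_k(t)_{t\ge0})_{1\le k<m}$; (b) $\mathcal L(X_m(0)\mid T_{m-1}>t_{m-1},\ldots,T_1>t_1)=\rho$ for $m\ge2$, and $\mathcal L(X_1(0))=\rho$, where $t_m>0$ are deterministic times satisfying $\sum_{m=1}^\infty t_m=\infty$. Define $L=\inf\{m\ge1: T_m\le t_m\}$, and let $g$ be a bounded measurable real-valued function on state space. Let $X(t)_{t\ge0}$ be such that $\mathcal L(X(0))=\rho$, and set $T=\inf\{t>0:X(t)\notin U\}$. Then in the discrete time case $$\mathbb E\left(\sum_{m=1}^{L}\ \sum_{t=0}^{T_m\wedge t_m-1} g(X_m(t))\right)=\mathbb E\left(\sum_{t=0}^{T-1}g(X(t))\right),$$ while in the continuous time case $$\mathbb E\left(\sum_{m=1}^{L}\int_0^{T_m\wedge t_m} g(X_m(t))\,dt\right)=\mathbb E\left(\int_0^{T}g(X(t))\,dt\right).$$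
   Context: The process takes values in a standard Borel state space (with a topology, so that ''open'' and ''càdlàg'' make sense). Time is either discrete ($t\in\{0,1,2,\dots\}$, in which case the times $t_m$ are integers) or continuous ($t\in[0,\infty)$). $\mathcal L$ denotes probability law, and $a\wedge b=\min\{a,b\}$. A random object is called a copy of another random object if it has the same law as that object. A probability measure $\rho$ is a QSD of $X(t)_{t\ge0}$ in $U$ if $\rho(U)=1$ and, with $T=\inf\{t\ge0:X(t)\notin U\}$, $\rho(A)=\mathbb P(X(t)\in A\mid \mathcal L(X(0))=\rho,\ T>t)$ for every $t\ge0$ and measurable $A\subseteq U$. Standing assumption: the QSD of $X(t)_{t\ge0}$ in $U$ exists, is unique, and for any initial distribution of $X(0)$ supported in $U$ one has $\rho(A)=\lim_{t\to\infty}\mathbb P(X(t)\in A\mid X(s)\in U\text{ for } s\in[0,t])$ for all measurable $A\subseteq U$. *)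

(* Defs.v *)
From HB Require Import structures.
From mathcomp Require Import all_boot all_order all_algebra.
From mathcomp Require Import all_classical all_reals all_analysis.
From mathcomp Require Import measurable_realfun.
Set Implicit Arguments.
Unset Strict Implicit.
Unset Printing Implicit Defensive.
Import Order.TTheory GRing.Theory Num.Theory.
Import numFieldNormedType.Exports.
Local Open Scope classical_set_scope.
Local Open Scope ring_scope.
Local Open Scope ereal_scope.

Notation borel E := (g_sigma_algebraType (@open E)).

(* Isomorphic, as a measurable space, to a Polish space with its Borel sets. *)
Definition standard_borel (R : realType) (E : pseudoPMetricType R) : Prop :=
  exists S : completePseudoMetricType R,
    [/\ hausdorff_space S, @second_countable S &
      exists (f : borel E -> borel S) (h : borel S -> borel E),
        [/\ measurable_fun setT f, measurable_fun setT h,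
            cancel f h & cancel h f]].

Variant time_kind := Discrete | Continuous.

Definition times (R : realType) (k : time_kind) : set R :=
  match k with
  | Discrete => range (fun n : nat => n%:R : R)
  | Continuous => [set t : R | (0 <= t)%R]
  end.
Arguments times R k : clear implicits.

(* Paths are total functions on R, of which only the values at the times in
   [times R k] are relevant: all definitions below ignore the other values. *)
Definition cylinders (R : realType) (k : time_kind) (E : pseudoPMetricType R) :
    set (set (R -> E)) :=
  [set C | exists2 t, times R k t &
     exists2 A : set (borel E), measurable A & C = [set x | A (x t)]].
Arguments cylinders {R} k E.

Notation path_space k E := (g_sigma_algebraType (cylinders k E)).

Section paths.
Context (R : realType) (k : time_kind) (E : pseudoPMetricType R).
Implicit Types (x : R -> E) (U : set E).

Definition cadlag x : Prop :=
  match k with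
  | Discrete => True
  | Continuous =>
      (forall t : R, (0 <= t)%R -> x s @[s --> t^'+] --> x t) /\
      (forall t : R, (0 < t)%R -> exists l : E, x s @[s --> t^'-] --> l)
  end.

Definition shift (s : R) x : R -> E := fun t => x (s + t)%R.

Definition exit_time U x : \bar R :=
  ereal_inf [set t%:E | t in [set t | times R k t /\ ~ U (x t)]].

Definition pos_exit_time U x : \bar R :=
  ereal_inf [set t%:E | t in [set t | [/\ times R k t, (0 < t)%R & ~ U (x t)]]].

(* The sum over the integers t in [0, tau - 1] for an integer or infinite tau,
   resp. the integral over [0, tau[. *)
Definition total_over (f : R -> R) (tau : \bar R) : \bar R :=
  match k with
  | Discrete => \sum_(0 <= n <oo | (n%:R%:E < tau)) (f n%:R)%:E
  | Continuous =>
      \int[@lebesgue_measure R]_(t in [set t : R | (0 <= t)%R /\ t%:E < tau])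
        (f t)%:E
  end.

End paths.
Arguments cadlag {R} k {E} x.
Arguments exit_time {R} k {E} U x.
Arguments pos_exit_time {R} k {E} U x.
Arguments total_over {R} k f tau.

Definition cond_prob d (T : measurableType d) (R : realType)
    (P : set T -> \bar R) (B A : set T) : R :=
  (fine (P (A `&` B)) / fine (P B))%R.

Section conditional_independence.
Context d (T : measurableType d) (R : realType) (P : probability T R).
Implicit Types (G F : set (set T)) (A : set T).

(* f is a version of P(A | G), for a sub-sigma-algebra G. *)
Definition cond_prob_version G A (f : T -> R) : Prop :=
  [/\ forall B : set R, measurable B -> G (f @^-1` B),
      P.-integrable setT (EFin \o f) &
      forall C, G C -> \int[P]_(w in C) (f w)%:E = P (A `&` C)].

Definition cond_independent G F1 F2 : Prop :=
  forall A1 A2, F1 A1 -> F2 A2 -> exists f1 f2,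
    [/\ cond_prob_version G A1 f1, cond_prob_version G A2 f2 &
        cond_prob_version G (A1 `&` A2) (fun w => f1 w * f2 w)%R].

End conditional_independence.

(* The law P_mu = \int P_x mu(dx) under the initial distribution mu. *)
Definition mixture d1 d2 (T1 : measurableType d1) (T2 : measurableType d2)
    (R : realType) (P : R.-pker T1 ~> T2) (mu : probability T1 R)
    (A : set T2) : \bar R := \int[mu]_x P x A.

Section mixture_probability.
Context d1 d2 (T1 : measurableType d1) (T2 : measurableType d2)
  (R : realType) (P : R.-pker T1 ~> T2) (mu : probability T1 R).

Let mixture0 : mixture P mu set0 = 0.
Proof.
by rewrite /mixture (eq_integral (cst 0)) ?integral0// => x _; rewrite measure0.
Qed.

Let mixture_ge0 A : 0 <= mixture P mu A.
Proof. exact: integral_ge0. Qed.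

Let mixture_sigma_additive : semi_sigma_additive (mixture P mu).
Proof.
move=> F mF tF mUF; rewrite [X in _ --> X](_ : _ =
  \int[mu]_x (\sum_(n <oo) P x (F n))); last first.
  apply: eq_integral => x _.
  by apply/esym/cvg_lim => //; exact/measure_semi_sigma_additive.
apply/cvg_closeP; split.
  by apply: is_cvg_nneseries => n _ _; exact: integral_ge0.
rewrite closeE// integral_nneseries// => n.
exact: measurable_kernel.
Qed.

HB.instance Definition _ := isMeasure.Build _ _ R (mixture P mu)
  mixture0 mixture_ge0 mixture_sigma_additive.

Let mixture_setT : mixture P mu setT = 1.
Proof.
rewrite /mixture (eq_integral (cst 1)); last first.
  by move=> x _; rewrite prob_kernel.
by rewrite integral_cst// mul1e; exact: probability_setT.
Qed.

HB.instance Definition _ := Measure_isProbability.Build _ _ R (mixture P mu)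
  mixture_setT.

End mixture_probability.

(* A Markov process with unspecified initial distribution is a process X on W
   together with a kernel P, where P x is the probability on W under which X
   starts at x, and [mixture P mu] the one under which X(0) has law mu. *)
Section markov.
Context d (W : measurableType d) (R : realType) (k : time_kind)
  (E : pseudoPMetricType R).
Variables (X : {mfun W >-> path_space k E}) (P : R.-pker (borel E) ~> W).

Definition natural_filtration (t : R) : set (set W) :=
  <<s [set B | exists2 s, times R k s /\ (s <= t)%R &
        exists2 A : set (borel E), measurable A & B = [set w | A (X w s)]] >>.

Definition stopping_time (tau : W -> \bar R) : Prop :=
  (forall w, tau w = +oo \/ exists2 t, times R k t & tau w = t%:E) /\
  (forall t, times R k t -> natural_filtration t [set w | tau w <= t%:E]).

Definition stopped_events (tau : W -> \bar R) : set (set W) :=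
  [set B | measurable B /\ forall t, times R k t ->
     natural_filtration t (B `&` [set w | tau w <= t%:E])].

Definition markov_property : Prop :=
  forall x s t (B : set W) (A : set (borel E)),
    times R k s -> times R k t -> natural_filtration s B -> measurable A ->
    P x (B `&` [set w | A (X w (s + t)%R)]) =
    \int[P x]_(w in B) P (X w s) [set w' | A (X w' t)].

Definition strong_markov_property : Prop :=
  forall x tau (B : set W) (C : set (path_space k E)),
    stopping_time tau -> stopped_events tau B -> measurable C ->
    P x (B `&` [set w | tau w < +oo] `&`
         [set w | C (shift (fine (tau w)) (X w))]) =
    \int[P x]_(w in B `&` [set w | tau w < +oo])
      P (X w (fine (tau w))) (X @^-1` C).

Definition starts_at_point : Prop :=
  forall x (A : set (borel E)), measurable A ->
    P x [set w | A (X w 0%R)] = \d_x A.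

Definition cadlag_strong_markov_process : Prop :=
  [/\ starts_at_point, forall w, cadlag k (X w : R -> E),
      markov_property & strong_markov_property].

Section qsd.
Variables (U : set (borel E)) (T : W -> \bar R).
Implicit Type rho : probability (borel E) R.

Definition is_qsd rho : Prop :=
  rho U = 1 /\
  forall t (A : set (borel E)), times R k t -> measurable A -> A `<=` U ->
    fine (rho A) =
    cond_prob (mixture P rho) [set w | t%:E < T w] [set w | A (X w t)].

(* P_mu(X(t) in A | X(s) in U for s in [0, t]) tends to rho(A), for every
   initial distribution mu supported in U. *)
Definition attracts rho : Prop :=
  forall mu : probability (borel E) R, mu U = 1 ->
  forall A : set (borel E), measurable A -> A `<=` U ->
    cond_prob (mixture P mu)
      [set w | forall s, times R k s -> (s <= t)%R -> U (X w s)]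
      [set w | A (X w t)]
    @[t --> within (times R k) +oo%R] --> fine (rho A).

Definition is_the_qsd rho : Prop :=
  [/\ is_qsd rho,
      forall rho', is_qsd rho' -> forall A, measurable A -> rho' A = rho A &
      attracts rho].

End qsd.

(* (Y, S) has the same law as (X, T), where X has some initial distribution
   mu (necessarily the law of Y(0)). *)
Definition is_copy (T : W -> \bar R) d' (W' : measurableType d')
    (Q : probability W' R) (Y : W' -> path_space k E) (S : W' -> \bar R) : Prop :=
  exists mu : probability (borel E) R,
  forall C : set (path_space k E * \bar R), measurable C ->
    Q [set w | C (Y w, S w)] = mixture P mu [set w | C (X w, T w)].

End markov.

Section copies.
Context d (W : measurableType d) (R : realType) (k : time_kind)
  (E : pseudoPMetricType R).

(* The sigma-algebra generated by Y_1, ..., Y_{m-1}. *)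
Definition past (Y : nat -> W -> path_space k E) (m : nat) : set (set W) :=
  <<s \bigcup_(j in [set j | (1 <= j < m)%N])
        preimage_set_system setT (Y j) measurable >>.

Definition first_exit (S : nat -> W -> \bar R) (t_ : nat -> R) (w : W) : \bar R :=
  ereal_inf [set m%:R%:E | m in [set m | (1 <= m)%N /\ S m w <= (t_ m)%:E]].

End copies.

(* Main.v *)
Require Import Defs.
From HB Require Import structures.
From mathcomp Require Import all_boot all_order all_algebra.
From mathcomp Require Import all_classical all_reals all_analysis.
From mathcomp Require Import measurable_realfun.
Set Implicit Arguments.
Unset Strict Implicit.
Unset Printing Implicit Defensive.
Import Order.TTheory GRing.Theory Num.Theory.
Import numFieldNormedType.Exports.
Local Open Scope classical_set_scope.
Local Open Scope ring_scope.

(* Let S(t) = P_rho(T > t). Quasi-stationarity gives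
     P_rho(T > t, X(t) in A) = S(t) rho(A),
   and with the Markov property S(s + t) = S(s) S(t). By (a) and (b), given
   survival of the first m - 1 stages, (X_m, T_m) has the law of (X, T) under
   P_rho; hence stage m is reached with probability S(t_1 + ... + t_(m-1)), and
   by Fubini its expected reward is rho(g) \int_[0, t_m) S. Multiplicativity
   turns the sum over the stages into rho(g) \int_[0, oo) S, the integral over
   the consecutive intervals [t_1 + ... + t_(m-1), t_1 + ... + t_m) being the one
   over [0, oo); this is also the expected reward of X until T. As T is finite,
   S(n) < 1 for some n, so that S is integrable and signed rewards reduce to
   nonnegative ones.

   The exit time T need not be measurable with respect to the cylinder
   sigma-algebra, so that "T > t" cannot be used directly in (a) or in the strong
   Markov property. It agrees almost surely with a measurable function of the
   path, the largest (in law) measurable random time below T: from a random time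
   phi <= T at which the path is still in the open set U, one can always move on
   to a later measurable random time below T. *)

(** * Reading paths at random times *)

(** A maximizing random time is used because countable iteration need not reach the exit time. A
    path may have a left limit outside [U] at some time and jump back into [U] at that very time,
    without having left; the first exits from the sets [inner U i] then increase to this time only.
    Such times can accumulate and be followed by further ones, so that successive restarts might run
    through countable ordinals. Maximizing over all measurable minorants avoids this, at the price
    of a null set that depends on the law. Hence the approximation [phi] is a function on path
    space, not on [W]: it can be evaluated on copies, on shifted paths and on stopped paths, and it
    is rebuilt for each law under consideration.

    Positivity of the conditioning probabilities comes from a convention: [cond_prob] is [0] when it
    divides by [0]. Applied to an event of full measure, quasi-stationarity and (b) exclude this
    value. *)

Section evaluation.
Context (R : realType) (k : time_kind) (E : pseudoPMetricType R).
Implicit Types (t : R) (y : path_space k E) (A : set E).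

(** In continuous time the sample point is the right end of the cell, hence strictly after every
    time of the cell, so that right-continuity alone controls it. In discrete time the cells are
    single integers, whatever [j]. *)
Definition cell_point (j n : nat) : R :=
  match k with
  | Discrete => n%:R%R
  | Defs.Continuous => (n.+1%:R / j.+1%:R)%R
  end.

Definition cell (j n : nat) : set R :=
  match k with
  | Discrete => [set n%:R]
  | Defs.Continuous => `[n%:R / j.+1%:R, n.+1%:R / j.+1%:R[%classic
  end.

Lemma measurable_cell j n : measurable (cell j n).
Proof. by rewrite /cell; case: k; [exact: measurable_set1|exact: measurable_itv]. Qed.

Lemma cell_point_times j n : times R k (cell_point j n).
Proof. by rewrite /cell_point /times; case: k => /=; [exists n|exact: divr_ge0]. Qed.

Lemma cell_cover j t : times R k t -> exists n, cell j n t.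
Proof.
rewrite /cell /times; case: k => /= [[n _ <-]|t0]; first by exists n.
exists (Num.trunc (t * j.+1%:R)%R).
have := @truncn_itv _ (t * j.+1%:R)%R; rewrite mulr_ge0// => /(_ isT) /andP[h1 h2].
by rewrite in_itv/= ler_pdivrMr// h1 /= ltr_pdivlMr.
Qed.

Lemma times_ge0 t : times R k t -> (0 <= t)%R.
Proof. by case: k => //= -[n _ <-]. Qed.

Lemma cadlag_cell y t (V : set E) : cadlag k (y : R -> E) -> times R k t ->
  nbhs (y t) V -> exists K : nat, forall j n, (K <= j)%N -> cell j n t -> V (y (cell_point j n)).
Proof.
rewrite /cadlag /times /cell /cell_point; case: k y => y /=.
  move=> _ _ Vt; exists 0%N => _ n _ tn; rewrite -tn.
  exact: nbhs_singleton.
move=> [yr _] t0 /(yr t t0)[e /= e0 eV].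
(* For [j] at least the integer part of [e^-1], the mesh [1 / (j + 1)] is smaller than [e]. *)
exists (Num.trunc e^-1) => j n Kj.
rewrite in_itv/= => /andP[tl tr]; apply: eV => //=.
rewrite /ball/= ltr_distlC; apply/andP; split; first by rewrite (lt_trans _ tr)// ltrBlDr ltrDl.
rewrite -natr1 mulrDl; apply: ler_ltD => //.
rewrite mul1r invf_plt ?posrE//.
have /truncn_itv/andP[_ h] : (0 <= e^-1)%R by rewrite invr_ge0 ltW.
by rewrite (lt_le_trans h)// ler_nat.
Qed.

(** The margin [1 / (i + 1)] survives passage to the limit: a limit of points of [inner A i] still
    lies in [A], which may fail for limits of points of [A]. The interior makes the set open, hence
    Borel. *)
Definition inner A (i : nat) : set E := [set x | ball x i.+1%:R^-1 `<=` A]°.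

Lemma open_inner A i : open (inner A i).
Proof. exact: open_interior. Qed.

Lemma inner_ball A i x z : inner A i x -> ball x i.+1%:R^-1 z -> A z.
Proof. by move=> /nbhs_singleton; apply. Qed.

Lemma inner_cover A x : open A -> A x -> exists i, inner A i x.
Proof.
move=> oA Ax; have /nbhs_ballP[e /= e0 eA] : nbhs x A by exact: open_nbhs_nbhs.
have e20 : (0 < e / 2)%R by rewrite divr_gt0.
exists (Num.trunc (e / 2)^-1); apply/nbhs_ballP; exists (e / 2)%R => //= z xz w zw.
apply: eA; rewrite [e]splitr; apply: ball_triangle xz _.
apply: le_ball zw; rewrite invf_ple ?posrE//.
have /truncn_itv/andP[_ /ltW//] : (0 <= (e / 2)^-1)%R by rewrite invr_ge0 ltW.
Qed.

(* On a cadlag path this is the event that y(t) lies in the open set A; reading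
   the path on countable grids only makes it measurable in (t, y). *)
Definition visits A : set (R * path_space k E) :=
  [set p | exists i K, forall j n, (K <= j)%N -> cell j n p.1 ->
    inner A i (p.2 (cell_point j n))].

Lemma measurable_coordinate t (B : set (borel E)) : times R k t -> measurable B ->
  measurable [set y : path_space k E | B (y t)].
Proof. by move=> tk mB; apply: sub_sigma_algebra; exists t => //; exists B. Qed.

Lemma measurable_visits A : measurable (visits A).
Proof.
have -> : visits A = \bigcup_i \bigcup_K \bigcap_j \bigcap_n
   [set p | (K <= j)%N -> cell j n p.1 -> inner A i (p.2 (cell_point j n))].
  apply/seteqP; split=> p.
    by move=> [i [K h]]; exists i => //; exists K => // j _ n _ /=; exact: h.
  by move=> [i _ [K _ h]]; exists i, K => j n; exact: (h j I n I).
apply: bigcup_measurable => i _; apply: bigcup_measurable => K _.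
apply: bigcap_measurable => // j _; apply: bigcap_measurable => // n _.
have [Kj|Kj] := leqP K j; last first.
  by rewrite (_ : [set _ | _] = setT)//; apply/seteqP; split=> //= p _; rewrite leqNgt Kj.
rewrite (_ : [set _ | _] = (~` cell j n `*` setT) `|`
   ((setT : set R) `*` [set y : path_space k E | inner A i (y (cell_point j n))])).
  apply: measurableU; apply: measurableX => //.
    by apply: measurableC; exact: measurable_cell.
  apply: measurable_coordinate; first exact: cell_point_times.
  by apply: sub_sigma_algebra; exact: open_inner.
apply/seteqP; split => [p /= h|p /= [[h _]|[_ h]]//].
by have [c|c] := pselect (cell j n p.1); [right; split => //=; exact: h|left].
Qed.

(** On a fine grid the sampled point lies in [inner A i] and within [1 / (i + 1)] of [y t], which
    puts [y t] in [A]. The converse is right-continuity at a point of the open set [inner A i]. *)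
Lemma visitsP A y t : open A -> cadlag k (y : R -> E) -> times R k t ->
  visits A (t, y) <-> A (y t).
Proof.
move=> oA cy tk; split => [[i [K /= h]]|Ay].
  have [K' h'] := cadlag_cell cy tk (nbhsx_ballx (y t) (i.+1%:R^-1) ltac:(by [])).
  have [n cn] := cell_cover (maxn K K') tk.
  apply: (inner_ball (h _ _ _ cn)); first exact: leq_maxl.
  by apply: ball_sym; apply: h' cn; exact: leq_maxr.
have [i iy] := inner_cover oA Ay.
have [K h] := cadlag_cell cy tk (open_nbhs_nbhs (conj (open_inner A i) iy)).
by exists i, K => j n Kj; exact: h.
Qed.

Lemma measurable_times : measurable (times R k).
Proof.
rewrite /times; case: k.
  rewrite [X in measurable X](_ : _ = \bigcup_n [set n%:R]).
    by apply: bigcup_measurable => n _; exact: measurable_set1.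
  by apply/seteqP; split=> [_ [n _ <-]|_ [n _ ->]]; exists n.
rewrite [X in measurable X](_ : _ = `[0%R, +oo[%classic); first exact: measurable_itv.
by apply/seteqP; split => x /=; rewrite in_itv/= andbT.
Qed.

(** Fubini requires joint measurability in time and outcome. Open sets generate the Borel sets, and
    for an open set the event is a preimage of [visits]. *)
Lemma measurable_process d (W : measurableType d) (Y : W -> path_space k E) :
  measurable_fun setT Y -> (forall w, cadlag k (Y w : R -> E)) ->
  measurable_fun (times R k `*` setT) (fun p => Y p.2 p.1 : borel E).
Proof.
move=> mY cY; apply: (@measurability _ _ _ (borel E) _ _ (@open E)) => [//|_ [A oA <-]].
rewrite [X in measurable X](_ : _ = (times R k `*` setT) `&`
   ((fun p : R * W => (p.1, Y p.2)) @^-1` visits A)).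
  apply: measurableI; first by apply: measurableX => //; exact: measurable_times.
  rewrite -[X in measurable X]setTI.
  suff : measurable_fun setT (fun p : R * W => (p.1, Y p.2)).
    by apply => //; exact: measurable_visits.
  apply/measurable_fun_pair => //.
  exact: measurableT_comp mY (@measurable_snd _ _ R W).
apply/seteqP; split => -[t w] [[/= tk _]] /= h; split=> //.
  exact: (visitsP oA (cY w) tk).2.
exact: (visitsP oA (cY w) tk).1.
Qed.

End evaluation.

(** * Exit times *)

Local Open Scope ereal_scope.

Lemma measurable_ereal_inf_range d (T : measurableType d) (R : realType)
    (f : nat -> T -> \bar R) : (forall n, measurable_fun setT (f n)) ->
  measurable_fun setT (fun x => ereal_inf (range (f ^~ x))).
Proof.
move=> mf; have := measurable_fun_einfs mf 0.
rewrite [X in measurable_fun _ X -> _](_ : _ = fun x => ereal_inf (range (f ^~ x)))//.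
apply/funext => x; rewrite /einfs; congr ereal_inf.
by apply/seteqP; split=> _ [n _ <-]; exists n.
Qed.

Lemma measurable_ereal_sup_range d (T : measurableType d) (R : realType)
    (f : nat -> T -> \bar R) : (forall n, measurable_fun setT (f n)) ->
  measurable_fun setT (fun x => ereal_sup (range (f ^~ x))).
Proof.
move=> mf; have := measurable_fun_esups mf 0.
rewrite [X in measurable_fun _ X -> _](_ : _ = fun x => ereal_sup (range (f ^~ x)))//.
apply/funext => x; rewrite /esups; congr ereal_sup.
by apply/seteqP; split=> _ [n _ <-]; exists n.
Qed.

Lemma measurable_fun_asbool d (T : measurableType d) (A : set T) :
  measurable A -> measurable_fun setT (fun x => `[< A x >]).
Proof.
move=> mA; apply: (measurable_fun_bool true); rewrite setTI.
by rewrite [X in measurable X](_ : _ = A)//; apply/seteqP; split=> x /asboolP.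
Qed.

Lemma cadlag_shift (R : realType) (k : time_kind) (E : pseudoPMetricType R)
    (s : R) (y : R -> E) :
  times R k s -> cadlag k y -> cadlag k (Defs.shift s y).
Proof.
case: k => //= s0 [yr yl]; split=> t t0.
  move=> V /(yr (s + t)%R (addr_ge0 s0 t0))[e /= e0 eV].
  exists e => //= u; rewrite /ball/= => tu lt; apply: eV => /=.
    by rewrite /ball/= opprD addrACA subrr add0r.
  by rewrite ltrD2l.
have [l yll] := yl (s + t)%R (ltr_wpDl s0 t0).
exists l => V /yll[e /= e0 eV].
exists e => //= u; rewrite /ball/= => tu lt; apply: eV => /=.
  by rewrite /ball/= opprD addrACA subrr add0r.
by rewrite ltrD2l.
Qed.

(** * Measurability of the exit time up to a null set, in continuous time *)

Section debut_continuous.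
Context (R : realType) (E : pseudoPMetricType R) (U : set E).
Hypothesis U_open : open U.
Local Notation path := (path_space Defs.Continuous E).
Implicit Types (y : path) (phi : path -> \bar R).

Let inside (i : nat) phi : set path :=
  [set y | phi y \is a fin_num /\ visits (inner U i) (fine (phi y), y)].

(* The first rational increment after phi at which the path is out of
   [inner U i], if the path lies in [inner U i] at time phi. *)
Let next (i : nat) phi y : \bar R :=
  if `[< inside i phi y >] then
    ereal_inf (range (fun j => ereal_inf (range (fun n =>
      let s := (phi y + (cell_point R Defs.Continuous j n)%:E) in
      if `[< visits (inner U i) (fine s, y) >] then +oo else s))))
  else phi y.

(** The path space contains all functions, and [visits] has its meaning on cadlag paths; hence the
    restriction in the last clause. *)
Let minorant phi : Prop :=
  [/\ measurable_fun setT phi, forall y, 0 <= phi y &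
      forall y, cadlag Defs.Continuous (y : R -> E) -> phi y <= exit_time Defs.Continuous U y].

Let measurable_visits_at (A : set E) phi : measurable_fun setT phi ->
  measurable [set y | visits A (fine (phi y), y)].
Proof.
move=> mphi.
suff : measurable_fun setT (fun y : path => (fine (phi y), y)).
  move=> /(_ measurableT (visits A)); rewrite setTI; apply.
  exact: measurable_visits.
apply/measurable_fun_pair => //.
exact: measurableT_comp mphi.
Qed.

Let measurable_inside i phi : measurable_fun setT phi -> measurable (inside i phi).
Proof.
move=> mphi; rewrite /inside [X in measurable X](_ : _ =
  (setT `&` phi @^-1` [set x | x \is a fin_num]) `&`
  [set y | visits (inner U i) (fine (phi y), y)]); last by rewrite setTI.
apply: measurableI; last exact: measurable_visits_at.
apply: mphi => //.
rewrite [X in measurable X](_ : _ = ~` ([set +oo] `|` [set -oo])).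
  by apply: measurableC; apply: measurableU; exact: emeasurable_set1.
apply/seteqP; split=> x /=.
  by move=> xfin [xE|xE]; move: xfin; rewrite xE.
by case: x => // h; exfalso; apply: h; [left|right].
Qed.

Let measurable_next i phi : measurable_fun setT phi -> measurable_fun setT (next i phi).
Proof.
move=> mphi; apply: measurable_fun_ifT => //.
  by apply: measurable_fun_asbool; exact: measurable_inside.
apply: measurable_ereal_inf_range => j; apply: measurable_ereal_inf_range => n.
have ms : measurable_fun setT (fun y => phi y + (cell_point R Defs.Continuous j n)%:E).
  exact: emeasurable_funD.
apply: measurable_fun_ifT => //.
by apply: measurable_fun_asbool; exact: measurable_visits_at.
Qed.

Let cell_point_gt0 j n : (0 < cell_point R Defs.Continuous j n)%R.
Proof. exact: divr_gt0. Qed.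

Let next_ge i phi y : phi y <= next i phi y.
Proof.
rewrite /next; case: asboolP => // _.
apply/ereal_infP => _ [j _ <-]; apply/ereal_infP => _ [n _ <-] /=.
by case: asboolP => _; [exact: leey|rewrite leeDl// lee_fin ltW].
Qed.

(** If the path is out of [U] at [t], the grid points just after [t] land within [1 / (i + 1)] of
    [y t], hence out of [inner U i], and they come arbitrarily close to [t]. Sampling against [U]
    itself could miss an exit at a single time. *)
Let next_le_exit i phi y : (forall y, 0 <= phi y) ->
  cadlag Defs.Continuous (y : R -> E) -> phi y <= exit_time Defs.Continuous U y ->
  next i phi y <= exit_time Defs.Continuous U y.
Proof.
move=> phi0 cy phile; rewrite /next; case: asboolP => // -[phifin iny].
apply/ereal_infP => _ [t [/= t0 nUt] <-].
have phit : phi y <= t%:E by rewrite (le_trans phile)//; apply: ereal_inf_lbound; exists t.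
rewrite -(fineK phifin) in phit *; move: phit.
have s0 : (0 <= fine (phi y))%R by rewrite fine_ge0.
set s := fine (phi y) in iny s0 *.
rewrite lee_fin => st; set I := ereal_inf _.
have [//|tI] := leP I t%:E; exfalso; apply: nUt.
have ts0 : (0 <= t - s)%R by rewrite subr_ge0.
have iv0 : (0 < i.+1%:R^-1 :> R)%R by [].
(* The grid is counted from [s], so the path is shifted by [s] and read at [t - s]. *)
have [K HK] := cadlag_cell (cadlag_shift (k := Defs.Continuous) s0 cy) ts0
  (nbhsx_ballx _ _ iv0).
have : exists K : nat, forall j n, (K <= j)%N -> cell Defs.Continuous j n (t - s)%R ->
    (s + cell_point R Defs.Continuous j n)%:E < I.
  (* Applied to the identity path, [cadlag_cell] says that the grid points themselves approach
     [t - s]; they are then eventually below [I - s]. *)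
  have cid : cadlag Defs.Continuous (fun x : R => x : R^o).
    split=> u _; first by apply: cvg_at_right_filter; exact: cvg_id.
    by exists u; apply: cvg_at_left_filter; exact: cvg_id.
  have [V nV VI] : exists2 V, nbhs (t - s)%R V & forall v, V v -> (s + v)%:E < I.
    move: tI; case: I => [r| |] //.
    - rewrite lte_fin => tr; exists (ball (t - s)%R (r - t)%R).
        by apply: nbhsx_ballx; rewrite subr_gt0.
      move=> v; rewrite /ball/= ltr_distlC => /andP[_].
      by rewrite lte_fin; rewrite [(_ + (r - t))%R]addrC addrA subrK ltrBrDl.
    - by move=> _; exists setT; [exact: filterT|move=> v _; exact: ltry].
  have [K' HK'] := cadlag_cell cid ts0 nV.
  by exists K' => j n Kj cn; exact: VI (HK' _ _ Kj cn).
move=> [K' HK'].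
have [n cn] := cell_cover (k := Defs.Continuous) (maxn K K') ts0.
have := HK' _ _ (leq_maxr _ _) cn; have := HK _ _ (leq_maxl _ _) cn.
set c := cell_point _ _ _ _; rewrite /Defs.shift subrKC => yb.
rewrite ltNge => /negP; apply: contra_notP => nUt.
apply: ereal_inf_le; exists (ereal_inf (range (fun n =>
   if `[< visits (inner U i) (fine (s%:E + (cell_point R Defs.Continuous (maxn K K') n)%:E), y) >]
   then +oo else s%:E + (cell_point R Defs.Continuous (maxn K K') n)%:E))).
  by exists (maxn K K').
apply: ge_ereal_inf; exists (s + c)%:E => //; exists n => //=.
case: asboolP => // /visitsP-/(_ (@open_inner _ _ _ _) cy) h; exfalso; apply: nUt.
have scT : times R Defs.Continuous (s + c)%R.
  by apply: addr_ge0 => //; apply: ltW; exact: cell_point_gt0.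
by apply: inner_ball (h scT) _; exact: ball_sym.
Qed.

Let next_minorant i phi : minorant phi -> minorant (next i phi).
Proof.
move=> [mphi phi0 phile]; split; first exact: measurable_next.
  by move=> y; rewrite (le_trans (phi0 y)).
by move=> y cy; apply: next_le_exit => //; exact: phile.
Qed.

(** If [phi y] were before the exit, the path would lie in some [inner U i] at that time and, by
    right-continuity, stay there for a duration [e]. Every grid point out of [inner U i] would then
    come at least [e] later, so [next i] would strictly increase [phi]. *)
Let next_gt phi y : minorant phi -> cadlag Defs.Continuous (y : R -> E) ->
  (forall i, next i phi y <= phi y) -> phi y = exit_time Defs.Continuous U y.
Proof.
move=> [mphi phi0 phile] cy nle; apply/eqP; rewrite eq_le phile//=.
have [->|phioo] := eqVneq (phi y) +oo; first exact: leey.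
have phifin : phi y \is a fin_num by rewrite ge0_fin_numE// ltey.
have s0 : (0 <= fine (phi y))%R by rewrite fine_ge0.
apply: contrapT => /negP; rewrite -ltNge => lt.
have Us : U (y (fine (phi y))).
  apply: contrapT => nU; move: lt; apply/negP; rewrite -leNgt.
  by apply: ereal_inf_lbound; exists (fine (phi y)) => //; rewrite fineK.
have [i iU] := inner_cover U_open Us.
have [e /= e0 eV] := cy.1 _ s0 _ (open_nbhs_nbhs (conj (open_inner U i) iU)).
have := nle i; rewrite /next; case: asboolP => [_|]; last first.
  move=> + _; apply; split => //; apply/visitsP => //; exact: open_inner.
apply/negP; rewrite -ltNge.
apply: (@lt_le_trans _ _ (phi y + e%:E)); first by rewrite lteDl.
apply/ereal_infP => _ [j _ <-]; apply/ereal_infP => _ [n _ <-] /=.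
case: asboolP => [_|nv]; first exact: leey.
rewrite leeD2lE// lee_fin leNgt; apply/negP => ce; apply: nv.
have c0 := cell_point_gt0 j n.
have -> : fine (phi y + (cell_point R Defs.Continuous j n)%:E) =
  (fine (phi y) + cell_point R Defs.Continuous j n)%R by rewrite fineD.
apply/visitsP => //; [exact: open_inner|by apply: addr_ge0 => //; exact: ltW|].
apply: eV => /=; last by rewrite ltrDl.
by rewrite /ball/= opprD addNKr normrN gtr0_norm.
Qed.

Let minorant_sup (f : nat -> path -> \bar R) : (forall n, minorant (f n)) ->
  minorant (fun y => ereal_sup (range (f ^~ y))).
Proof.
move=> mf; split.
- by apply: measurable_ereal_sup_range => n; have [] := mf n.
- move=> y; have [_ f0 _] := mf 0%N; apply: (le_trans (f0 y)).
  by apply: ereal_sup_ubound; exists 0%N.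
- move=> y cy; apply: ge_ereal_sup => _ [n _ <-].
  by have [_ _] := mf n; exact.
Qed.

(* A minorant maximizing all the probabilities [mu (c < phi \o Y)], c rational,
   is a.s. a fixed point of [next i] for all i. *)
Lemma debut_continuous d (W : measurableType d) (mu : probability W R)
    (Y : W -> path) : measurable_fun setT Y ->
  exists2 phi : path -> \bar R, measurable_fun setT phi &
  exists N : set path, [/\ measurable N, mu (Y @^-1` N) = 0 &
    forall y, cadlag Defs.Continuous (y : R -> E) -> ~ N y ->
      phi y = exit_time Defs.Continuous U y].
Proof.
move=> mY.
have mYpre A : measurable A -> measurable (Y @^-1` A).
  by move=> mA; rewrite -[X in measurable X]setTI; exact: mY.
pose c (p : nat * nat) : R := (p.1%:R / p.2.+1%:R)%R.
pose lev phi p := Y @^-1` [set y | (c p)%:E < phi y].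
have mlev0 phi p : measurable_fun setT phi -> measurable [set y | (c p)%:E < phi y].
  by move=> mphi; rewrite -[X in measurable X]setTI; exact: emeasurable_fun_o_infty.
have mlev phi p : measurable_fun setT phi -> measurable (lev phi p).
  by move=> mphi; apply: mYpre; exact: mlev0.
(* The largest probability that a minorant can give to exceeding the level [c p]; one minorant
   attaining it for all [p] at once is sought. *)
pose S p := ereal_sup [set mu (lev phi p) | phi in minorant].
have m0 : minorant (cst 0).
  split => // y _; apply/ereal_infP => _ [t [/= t0 _] <-]; exact: t0.
have Sfin p : S p \is a fin_num.
  rewrite ge0_fin_numE.
    rewrite (@le_lt_trans _ _ 1)// ?ltry//; apply: ge_ereal_sup => _ [phi [mphi _ _] <-].
    by apply: probability_le1; exact: mlev.
  by apply: (@le_trans _ _ (mu (lev (cst 0) p))) => //; apply: ereal_sup_ubound; exists (cst 0).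
have Sadh (q : nat * nat * nat) : exists phi, minorant phi /\
    S q.1 - (q.2.+1%:R^-1)%:E < mu (lev phi q.1).
  have [|_ [phi mphi <-] h] := @ub_ereal_sup_adherent _ _ (q.2.+1%:R^-1)%R _ (Sfin q.1) => //.
  by exists phi.
have [psi psiP] := choice Sadh.
(* An enumeration of near-maximizers for all levels and all precisions; their supremum [phi] does at
   least as well as each of them. The default [cst 0] is a minorant too. *)
pose f n := if unpickle n is Some q then psi q else cst 0.
have mf n : minorant (f n).
  by rewrite /f; case: unpickle => [q|//]; exact: (psiP q).1.
pose phi y := ereal_sup (range (f ^~ y)).
have mphi : minorant phi by exact: minorant_sup.
have phim : measurable_fun setT phi by have [] := mphi.
have muphi p : S p <= mu (lev phi p).
  apply/lee_addgt0Pr => e e0.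
  pose q := (p, Num.trunc e^-1).
  have := (psiP q).2; rewrite lteBlDr// => /ltW/le_trans; apply.
  apply: leeD.
    apply: le_measure; rewrite ?inE.
    - by apply: mlev; have [] := (psiP q).1.
    - exact: mlev.
    - move=> w /= /lt_le_trans; apply; apply: ereal_sup_ubound.
      by exists (pickle q) => //; rewrite /f pickleK.
  rewrite lee_fin invf_ple ?posrE//=.
  by have /truncn_itv/andP[_ /ltW] : (0 <= e^-1)%R by rewrite invr_ge0 ltW.
(* A strict increase from [phi] to [next i phi] crosses a rational level. As [next i phi] is again a
   minorant, it exceeds that level with no larger probability than [phi], so each of these countably
   many sets is null. *)
pose bad (i a b : nat) := [set y | (c (a, b))%:E < next i phi y] `\`
  [set y | (c (a, b))%:E < phi y].
have mbad i a b : measurable (bad i a b).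
  by apply: measurableD; apply: mlev0 => //; exact: measurable_next.
exists phi => //; exists (\bigcup_i \bigcup_a \bigcup_b bad i a b); split.
- by do 3 (apply: bigcup_measurable => ? _).
- apply/negligibleP.
    by apply: mYpre; do 3 (apply: bigcup_measurable => ? _).
  rewrite preimage_bigcup; apply: negligible_bigcup => i.
  rewrite preimage_bigcup; apply: negligible_bigcup => a.
  rewrite preimage_bigcup; apply: negligible_bigcup => b.
  apply/negligibleP; first exact: mYpre.
  have -> : Y @^-1` bad i a b = lev (next i phi) (a, b) `\` lev phi (a, b) by [].
  have mn : minorant (next i phi) by exact: next_minorant.
  have mln : measurable (lev (next i phi) (a, b)) by apply: mlev; have [] := mn.
  have ml : measurable (lev phi (a, b)) by exact: mlev.
  have sub : lev phi (a, b) `<=` lev (next i phi) (a, b).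
    by move=> w /= /lt_le_trans; apply.
  apply/eqP; rewrite eq_le measure_ge0 andbT.
  rewrite measureD//; last by rewrite -ge0_fin_numE// fin_num_measure.
  rewrite setIC (setIidl sub).
  rewrite sube_le0; apply: le_trans (muphi _).
  by apply: ereal_sup_ubound; exists (next i phi).
move=> y cy nN; apply: next_gt => // i.
rewrite leNgt; apply/negP => lt; apply: nN; exists i => //.
have phi0 : 0 <= phi y by have [_ + _] := mphi; exact.
have phifin : phi y \is a fin_num by rewrite ge0_fin_numE// (lt_le_trans lt)// leey.
(* As [next i phi y] may be infinite, a real number is inserted before a rational one. *)
have [r h1 h2] : exists2 r : R, phi y < r%:E & r%:E < next i phi y.
  move: lt; rewrite -(fineK phifin); case: (next i phi y) => [r| |]//.
    rewrite lte_fin => lt; exists ((fine (phi y) + r) / 2)%R; rewrite lte_fin.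
      by rewrite midf_lt.
    by rewrite midf_lt.
  by move=> _; exists (fine (phi y) + 1)%R; rewrite ?lte_fin ?ltrDl ?ltry.
have : (fine (phi y) < r)%R by rewrite -lte_fin fineK.
move=> /rat_in_itvoo[q]; rewrite in_itv/= => /andP[q1 q2].
have q0 : (0 <= q)%R.
  by rewrite -(@ler0q R) (le_trans _ (ltW q1))// fine_ge0.
(* The levels [c] have the form [a / (b + 1)], hence the predecessor of the denominator. *)
have [a [b qE]] : exists a b : nat, ratr q = (a%:R / b.+1%:R)%R :> R.
  exists `|numq q|%N, (`|denq q|%N.-1).
  rewrite prednK ?absz_gt0 ?denq_neq0// /ratr !natr_absz !ger0_norm ?denq_ge0//.
  by rewrite numq_ge0.
exists a => //; exists b => //; split=> /=; rewrite /c/= -qE.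
  by rewrite (lt_trans _ h2)// lte_fin.
by apply/negP; rewrite -leNgt -(fineK phifin) lee_fin ltW.
Qed.

End debut_continuous.

(** In discrete time the infimum over the integers is itself measurable, and the exceptional set is
    empty. In continuous time [phi] and [N] depend on the law of [Y]. *)
Lemma debut (R : realType) (k : time_kind) (E : pseudoPMetricType R) (U : set E)
    d (W : measurableType d) (mu : probability W R) (Y : W -> path_space k E) :
  open U -> measurable_fun setT Y ->
  exists2 phi : path_space k E -> \bar R, measurable_fun setT phi &
  exists N : set (path_space k E), [/\ measurable N, mu (Y @^-1` N) = 0 &
    forall y, cadlag k (y : R -> E) -> ~ N y -> phi y = exit_time k U y].
Proof.
move=> oU; case: k Y => Y mY; last exact: debut_continuous.
pose f n (y : path_space Discrete E) : \bar R :=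
  if `[< U (y n%:R%R) >] then +oo else n%:R%:E.
exists (fun y => ereal_inf (range (f ^~ y))).
  apply: measurable_ereal_inf_range => n; apply: measurable_fun_ifT => //.
  apply: measurable_fun_asbool; apply: (@measurable_coordinate _ Discrete E n%:R%R U).
    by exists n.
  by apply: sub_sigma_algebra.
exists set0; split; [exact: measurable0|by rewrite preimage_set0 measure0|].
move=> y _ _; apply/eqP; rewrite eq_le; apply/andP; split; apply/ereal_infP.
  move=> _ [_ [[n _ <-] nU] <-]; apply: ereal_inf_lbound; exists n => //.
  by rewrite /f; case: asboolP.
move=> _ [n _ <-]; rewrite /f; case: asboolP => [_|nU]; first exact: leey.
by apply: ereal_inf_lbound; exists n%:R%R => //; split => //; exists n.
Qed.

(** * Exit times of a single path: shifting, stopping, comparison with a fixed time *)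

Section exit_times.
Context (R : realType) (k : time_kind) (E : pseudoPMetricType R).
Implicit Types (s t : R) (y : R -> E) (U : set E).

Lemma times0 : times R k 0%R.
Proof. by case: k => //=; exists 0%N. Qed.

Lemma timesD s t : times R k s -> times R k t -> times R k (s + t)%R.
Proof.
case: k => /=; last exact: addr_ge0.
by move=> [m _ <-] [n _ <-]; exists (m + n)%N => //; rewrite natrD.
Qed.

Lemma timesB s t : times R k s -> times R k t -> (s <= t)%R -> times R k (t - s)%R.
Proof.
case: k => /=; last by rewrite subr_ge0.
by move=> [m _ <-] [n _ <-]; rewrite ler_nat => mn; exists (n - m)%N => //; rewrite natrB.
Qed.

Lemma times_min s t : times R k s -> times R k t -> times R k (Num.min s t).
Proof. by move=> ks kt; rewrite minEle; case: ifP. Qed.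

Lemma times_natr (n : nat) : times R k n%:R%R.
Proof. by case: k => /=; [exists n|exact: ler0n]. Qed.

(** Every cylinder event of the stopped path depends on the original path up to [tau] only. This is
    how survival up to [tau] enters the natural filtration at [tau]. *)
Definition stop_path (tau : R) y : R -> E := fun t => y (Num.min t tau).

Lemma cadlag_stop tau y : times R k tau -> cadlag k y -> cadlag k (stop_path tau y).
Proof.
rewrite /cadlag /times; case: k => //= tau0 [yr yl]; split=> t t0.
  have [tt|tt] := ltP t tau.
    move=> V; rewrite /stop_path min_l ?(ltW tt)// => /(yr t t0)[e /= e0 eV].
    exists (Num.min e (tau - t))%R => /=; first by rewrite lt_min e0 subr_gt0.
    move=> u; rewrite /ball/= lt_min => /andP[ue ut] tu.
    have {}ut : (u < tau)%R by move: ut; rewrite ltr_distlC subrKC => /andP[].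
    by rewrite min_l ?(ltW ut)//; exact: eV.
  move=> V /nbhs_singleton; rewrite /stop_path min_r// => Vt.
  exists 1%R => //= u _ tu; rewrite min_r//.
  exact: le_trans (ltW tu).
have [tt|tt] := leP t tau.
  have [l yll] := yl t t0; exists l => V /yll[e /= e0 eV].
  exists e => //= u ue ut; rewrite /stop_path min_l; last exact: le_trans (ltW ut) tt.
  exact: eV.
exists (y tau) => V /nbhs_singleton Vy; exists (t - tau)%R => /=; first by rewrite subr_gt0.
move=> u; rewrite /ball/= => ut _.
have {}ut : (tau < u)%R by move: ut; rewrite ltr_distlC opprB subrKC => /andP[].
by rewrite /stop_path min_r// ltW.
Qed.

(** The inequality is strict because staying in the open set [U] up to and including [t] leaves a
    margin after [t]: by right-continuity, or of length [1] in discrete time. *)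
Lemma lt_exit_timeP U y t : open U -> cadlag k y -> times R k t ->
  t%:E < exit_time k U y <-> (forall s, times R k s -> (s <= t)%R -> U (y s)).
Proof.
move=> oU cy kt; split=> [lt s ks st|h].
  apply: contrapT => nU; move: lt; apply/negP; rewrite -leNgt.
  apply: (@le_trans _ _ s%:E); last by rewrite lee_fin.
  by apply: ereal_inf_lbound; exists s.
suff [e e0 eU] : exists2 e, (0 < e)%R & forall s, times R k s -> (s < t + e)%R -> U (y s).
  apply: (@lt_le_trans _ _ (t + e)%:E); first by rewrite lte_fin ltrDl.
  apply/ereal_infP => _ [s [ks nU] <-]; rewrite lee_fin leNgt.
  by apply/negP => /(eU _ ks).
move: cy kt h; rewrite /cadlag /times; case: k => /=.
  move=> _ [n _ <-] h; exists 1%R => // s [m _ <-].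
  rewrite natr1 ltr_nat ltnS => mn; apply: h; first by exists m.
  by rewrite ler_nat.
move=> [yr _] t0 h.
have [e /= e0 eU] := yr t t0 U (open_nbhs_nbhs (conj oU (h t t0 (lexx t)))).
exists e => // s s0 ste; have [st|ts] := leP s t; first exact: h.
by apply: eU => //; rewrite /ball/= ltr_distlC ste andbT ltrBlDr (lt_trans ts)// ltrDl.
Qed.

Lemma lt_exit_timeD U y s t : open U -> cadlag k y -> times R k s -> times R k t ->
  (s + t)%:E < exit_time k U y <->
  s%:E < exit_time k U y /\ t%:E < exit_time k U (Defs.shift s y).
Proof.
move=> oU cy ks kt.
have cs := cadlag_shift ks cy.
split=> [/(lt_exit_timeP oU cy (timesD ks kt)) h|[]].
  split; first apply/lt_exit_timeP => // u ku us.
    by apply: h => //; rewrite (le_trans us)// lerDl (times_ge0 kt).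
  apply/lt_exit_timeP => // u ku ut; rewrite /Defs.shift; apply: h; first exact: timesD.
  by rewrite lerD2l.
move=> /(lt_exit_timeP oU cy ks) h1 /(lt_exit_timeP oU cs kt) h2.
apply/(lt_exit_timeP oU cy (timesD ks kt)) => u ku ust.
have [us|su] := leP u s; first exact: h1.
have := h2 (u - s)%R; rewrite /Defs.shift subrKC; apply.
  by apply: timesB => //; exact: ltW.
by rewrite lerBlDl.
Qed.

Lemma lt_exit_time_stop U y t : open U -> cadlag k y -> times R k t ->
  t%:E < exit_time k U (stop_path t y) <-> t%:E < exit_time k U y.
Proof.
move=> oU cy kt; have cs := cadlag_stop kt cy.
by split=> [/(lt_exit_timeP oU cs kt) h|/(lt_exit_timeP oU cy kt) h];
  apply/lt_exit_timeP => // s ks st; have := h s ks st; rewrite /stop_path min_l.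
Qed.

Lemma pos_exit_timeE U y : U (y 0%R) -> pos_exit_time k U y = exit_time k U y.
Proof.
move=> U0; congr ereal_inf; apply/seteqP; split=> _ [t + <-]; last first.
  move=> [kt nU]; exists t => //; split => //.
  rewrite lt_neqAle (times_ge0 kt) andbT; apply: contra_notN nU => /eqP <-.
  exact: U0.
by move=> [kt _ nU]; exists t.
Qed.

End exit_times.

Section exit_time_process.
Context d (W : measurableType d) (R : realType) (k : time_kind)
  (E : pseudoPMetricType R) (Y : W -> path_space k E).
Hypothesis mY : measurable_fun setT Y.

Lemma measurable_process_at (t : R) (A : set (borel E)) : times R k t ->
  measurable A -> measurable [set w | A (Y w t)].
Proof.
move=> kt mA; rewrite -[X in measurable X]setTI.
exact: (mY measurableT (measurable_coordinate kt mA)).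
Qed.

End exit_time_process.

(** * Integration *)

Section integration.
Context d (T : measurableType d) (R : realType).
Implicit Types (f g : T -> \bar R).

Import HBNNSimple.

(** The usual extension from indicators: simple functions are finite nonnegative combinations of
    indicators, and every nonnegative measurable function is an increasing limit of simple ones. *)
Lemma ge0_measurable_fun_ind (P : (T -> \bar R) -> Prop) :
  (forall A, measurable A -> P (fun x => (\1_A x)%:E)) ->
  (forall f g, measurable_fun setT f -> measurable_fun setT g ->
     (forall x, 0 <= f x) -> (forall x, 0 <= g x) ->
     P f -> P g -> P (fun x => f x + g x)) ->
  (forall (r : R) f, (0 <= r)%R -> measurable_fun setT f -> (forall x, 0 <= f x) ->
     P f -> P (fun x => r%:E * f x)) ->
  (forall u : nat -> T -> \bar R, (forall n, measurable_fun setT (u n)) ->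
     (forall n x, 0 <= u n x) -> (forall x, nondecreasing_seq (u ^~ x)) ->
     (forall n, P (u n)) -> P (fun x => limn (u ^~ x))) ->
  forall f, measurable_fun setT f -> (forall x, 0 <= f x) -> P f.
Proof.
move=> P1 PD PZ Plim f mf f0.
have Psfun (h : {nnsfun T >-> R}) : P (fun x => (h x)%:E).
  pose s : seq R := finmap.enum_fset (fset_set (h @` setT)).
  rewrite [X in P X](_ : _ = fun x =>
    \sum_(r <- s) (r%:E * (\1_(h @^-1` [set r]) x)%:E)); last first.
    by apply/funext => x; rewrite fimfunE fsbig_finite//= -sumEFin.
  have : forall r, r \in s -> (0 <= r)%R.
    by move=> r; rewrite in_fset_set// inE => -[x _ <-]; exact: fun_ge0.
  elim: s => [|r l IH] rl0.
    rewrite [X in P X](_ : _ = fun x => (\1_(set0 : set T) x)%:E).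
      exact: P1.
    by apply/funext => x; rewrite big_nil indic0.
  have r0 : (0 <= r)%R by apply: rl0; rewrite mem_head.
  have l0 q : q \in l -> (0 <= q)%R by move=> ql; apply: rl0; rewrite in_cons ql orbT.
  rewrite [X in P X](_ : _ = fun x => r%:E * (\1_(h @^-1` [set r]) x)%:E +
     \sum_(r <- l) (r%:E * (\1_(h @^-1` [set r]) x)%:E)); last first.
    by apply/funext => x; rewrite big_cons.
  have mi q : measurable_fun setT (fun x => (\1_(h @^-1` [set q]) x : R)%:E).
    by apply/measurable_EFinP; exact: measurable_indic.
  apply: PD.
  - exact: measurable_funeM.
  - by apply: emeasurable_sum => q; exact: measurable_funeM.
  - by move=> x; rewrite mule_ge0// lee_fin.
  - move=> x; rewrite big_seq; apply: sume_ge0 => q ql.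
    by rewrite mule_ge0// lee_fin// l0.
  - apply: PZ => //; exact: P1.
  - exact: IH.
pose g := nnsfun_approx measurableT mf.
rewrite [X in P X](_ : _ = fun x => limn (fun n => (g n x)%:E)); last first.
  by apply/funext => x; apply/esym/cvg_lim => //; exact: cvg_nnsfun_approx.
apply: Plim => //.
- by move=> n; apply/measurable_EFinP.
- by move=> n x; rewrite lee_fin.
- by move=> x m n mn; rewrite lee_fin; exact/lefP/nd_nnsfun_approx.
Qed.

(* The integral of a nonnegative function is a supremum over the simple functions
   below it, so that [f] and [g] may be nonmeasurable. *)
Lemma integral_null_set (mu : {measure set T -> \bar R}) (N : set T) f g :
  measurable N -> mu N = 0 -> (forall x, ~ N x -> f x = g x) ->
  \int[mu]_x f x = \int[mu]_x g x.
Proof.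
move=> mN N0.
have le (u v : T -> \bar R) : (forall x, 0 <= u x) -> (forall x, 0 <= v x) ->
    (forall x, ~ N x -> u x = v x) -> \int[mu]_x u x <= \int[mu]_x v x.
  move=> u0 v0 uv; rewrite !ge0_integralTE//; apply: ge_ereal_sup => _ [h /= hu <-].
  rewrite -integralT_nnsfun (ge0_negligible_integral mN)//; last 2 first.
    exact/measurable_EFinP.
    by move=> x _; rewrite lee_fin.
  rewrite setTD integral_nnsfun; last exact: measurableC.
  rewrite (mrestrict h (measurableC mN)).
  (* Multiplied by the indicator of the complement of [N], the simple function keeps its integral
     and lies below [v] everywhere. *)
  apply: ereal_sup_ubound; exists (proj_nnsfun h (measurableC mN)) => //= x.
  rewrite mindicE; have [xN|xN] := boolP (x \in ~` N).
    rewrite mulr1 (le_trans (hu x))// uv//; exact: set_mem.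
  by rewrite mulr0.
move=> fg; rewrite integralE [RHS]integralE; congr (_ - _); apply/eqP; rewrite eq_le;
  by apply/andP; split; apply: le => // x xN; rewrite ?funeposE ?funenegE fg.
Qed.

(** The hypothesis says that the measures with densities [w1] and [w2] have the same image under
    [p1] and [p2]. It serves both for transporting laws and, with [p1] and [p2] identities into a
    smaller sigma-algebra, for conditional expectations. *)
Lemma eq_weighted_integral d1 (T1 : measurableType d1) d2 (T2 : measurableType d2)
    (m1 : {measure set T1 -> \bar R}) (m2 : {measure set T2 -> \bar R})
    (p1 : T1 -> T) (p2 : T2 -> T) (w1 : T1 -> R) (w2 : T2 -> R) :
  measurable_fun setT p1 -> measurable_fun setT p2 ->
  measurable_fun setT w1 -> measurable_fun setT w2 ->
  (forall x, 0 <= w1 x)%R -> (forall x, 0 <= w2 x)%R ->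
  (forall A, measurable A ->
     \int[m1]_(x in p1 @^-1` A) (w1 x)%:E = \int[m2]_(x in p2 @^-1` A) (w2 x)%:E) ->
  forall f, measurable_fun setT f -> (forall x, 0 <= f x) ->
    \int[m1]_x (f (p1 x) * (w1 x)%:E) = \int[m2]_x (f (p2 x) * (w2 x)%:E).
Proof.
move=> mp1 mp2 /measurable_EFinP mw1 /measurable_EFinP mw2 w10 w20 eqA.
apply: ge0_measurable_fun_ind.
- move=> A mA; have := eqA A mA.
  rewrite integral_mkcond [RHS]integral_mkcond !epatch_indic => h.
  by under eq_integral do rewrite muleC; rewrite [LHS]h; under eq_integral do rewrite muleC.
- move=> f g mf mg f0 g0 ef eg.
  under eq_integral do rewrite ge0_muleDl//.
  under [in RHS]eq_integral do rewrite ge0_muleDl//.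
  rewrite !ge0_integralD// ?ef ?eg//; try by move=> x _; rewrite mule_ge0// lee_fin.
  1-4: by apply: emeasurable_funM => //; exact: measurableT_comp.
- move=> r f r0 mf f0 ef.
  under eq_integral do rewrite -muleA.
  under [in RHS]eq_integral do rewrite -muleA.
  rewrite !ge0_integralZl// ?ef//; try by move=> x _; rewrite mule_ge0// lee_fin.
  1-2: by apply: emeasurable_funM => //; exact: measurableT_comp.
- move=> u mu u0 ndu eu.
  have key d3 (T3 : measurableType d3) (m : {measure set T3 -> \bar R})
      (p : T3 -> T) (w : T3 -> R) : measurable_fun setT p -> measurable_fun setT (EFin \o w) ->
      (forall x, 0 <= w x)%R ->
      \int[m]_x (limn (u ^~ (p x)) * (w x)%:E) = limn (fun n => \int[m]_x (u n (p x) * (w x)%:E)).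
    move=> mp mw w0; rewrite -monotone_convergence//.
    + apply: eq_integral => x _; rewrite muleC -limeMl//; last exact: ereal_nondecreasing_is_cvgn.
      by apply: congr_lim; apply/funext => n; rewrite muleC.
    + by move=> n; apply: emeasurable_funM => //; exact: measurableT_comp.
    + by move=> n x _; rewrite mule_ge0// lee_fin.
    + by move=> x _ m' n' mn; rewrite lee_wpmul2r ?lee_fin//; exact: ndu.
  rewrite !key//; apply: congr_lim; apply/funext => n; exact: eu.
Qed.

End integration.

Lemma integral_mixture d1 d2 (T1 : measurableType d1) (T2 : measurableType d2)
    (R : realType) (P : R.-pker T1 ~> T2) (mu : probability T1 R) (f : T2 -> \bar R) :
  measurable_fun setT f -> (forall x, 0 <= f x) ->
  \int[mixture P mu]_x f x = \int[mu]_x \int[P x]_y f y.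
Proof.
move: f; have mk (f : T2 -> \bar R) : measurable_fun setT f -> (forall x, 0 <= f x) ->
    measurable_fun setT (fun x => \int[P x]_y f y).
  by move=> mf f0; apply: measurable_fun_integral_kernel => // U mU; exact: measurable_kernel.
apply: ge0_measurable_fun_ind.
- move=> A mA; rewrite integral_indic// setIT.
  by apply: eq_integral => x _; rewrite integral_indic// setIT.
- move=> f g mf mg f0 g0 ef eg; rewrite ge0_integralD// ef eg -ge0_integralD//;
    try exact: mk; try by move=> x _; exact: integral_ge0.
  by apply: eq_integral => x _; rewrite ge0_integralD.
- move=> r f r0 mf f0 ef; rewrite ge0_integralZl// ef -ge0_integralZl//;
    try exact: mk; try by move=> x _; exact: integral_ge0.
  by apply: eq_integral => x _; rewrite ge0_integralZl.
- move=> u mu' u0 ndu eu; rewrite monotone_convergence//.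
  transitivity (\int[mu]_x limn (fun n => \int[P x]_y u n y)); last first.
    by apply: eq_integral => x _; rewrite monotone_convergence.
  rewrite monotone_convergence//.
  + by apply: congr_lim; apply/funext => n; exact: eu.
  + by move=> n; exact: mk.
  + by move=> n x _; exact: integral_ge0.
  + move=> x _ m n mn; apply: ge0_le_integral => // y _; exact: ndu.
Qed.

(** * Conditional independence *)

Section null_sets.
Context d (T : measurableType d) (R : realType) (mu : {measure set T -> \bar R}).

Lemma eq_measure_mod_null (A B N : set T) : measurable A -> measurable B ->
  measurable N -> mu N = 0 -> (forall x, ~ N x -> A x <-> B x) -> mu A = mu B.
Proof.
move=> mA mB mN N0 AB.
rewrite -[A]setIT -[B]setIT -!integral_indic//.
apply: (integral_null_set mN N0) => x /AB AB'.
rewrite !indicE; congr (_%:R%:E); congr nat_of_bool.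
by apply/idP/idP; rewrite !inE => /AB'.
Qed.

End null_sets.

Section conditional_independence.
Context d (T : measurableType d) (R : realType) (P : probability T R).
Variable G : set (set T).
Hypotheses (G_sigma : sigma_algebra setT G) (G_measurable : G `<=` measurable).

(** Over [N] the integral of [f] is a probability, hence nonnegative, whereas [f] is negative there;
    so the integral of its absolute value vanishes. *)
Lemma cond_prob_version_ge0 A (f : T -> R) : measurable A ->
  cond_prob_version P G A f -> P [set w | (f w < 0)%R] = 0.
Proof.
move=> mA [Gf intf intfE]; pose N := [set w | (f w < 0)%R].
have GN : G N.
  rewrite (_ : N = f @^-1` `]-oo, 0%R[%classic); first exact: Gf.
  by apply/seteqP; split=> w /=; rewrite in_itv.
have mN := G_measurable GN.
have mf : measurable_fun setT f by move=> _ B mB; rewrite setTI; apply: G_measurable; exact: Gf.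
have intN : P.-integrable N (EFin \o f) by exact: integrableS intf.
have : \int[P]_(w in N) `|(f w)%:E| = 0.
  apply/eqP; rewrite eq_le; apply/andP; split; last exact: integral_ge0.
  rewrite (eq_integral (fun w => - (f w)%:E)); last first.
    by move=> w; rewrite inE /N/= => fw0; rewrite ltr0_norm.
  rewrite integralN/=; last exact: integrable_add_def.
  by rewrite intfE// leeNl oppe0.
move/(ae_eq_integral_abs P mN) => -[].
  by apply/measurable_EFinP; exact: measurable_funTS.
move=> M [mM M0 NM]; apply: (subset_measure0 mN mM _ M0) => w Nw; apply: NM => /= /(_ Nw) [fw0].
by move: Nw; rewrite /N/= fw0 ltxx.
Qed.

(** Here [h] is another version of the conditional probability of [A1]. Starting from the integral
    of [f1 f2], the factor [f1] is exchanged for [h], then [f2] for the indicator of [A2]; each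
    exchange is legitimate because the other factor is measurable for [G]. Positive parts allow
    arguing with nonnegative functions. *)
Lemma cond_independent_integral F1 F2 A1 A2 (h : T -> R) :
  cond_independent P G F1 F2 -> F1 A1 -> F2 A2 -> measurable A1 -> measurable A2 ->
  (forall B, measurable B -> G (h @^-1` B)) -> (forall w, 0 <= h w)%R ->
  (forall C, G C -> \int[P]_(w in C) (h w)%:E = P (A1 `&` C)) ->
  P (A1 `&` A2) = \int[P]_(w in A2) (h w)%:E.
Proof.
move=> ci FA1 FA2 mA1 mA2 Gh h0 hE.
have [f1 [f2 [v1 v2 [Gf12 intf12 f12E]]]] := ci _ _ FA1 FA2.
have GT : G setT by case: G_sigma => G0 GC _; rewrite -(setD0 setT); exact: GC.
have [Gf1 intf1 f1E] := v1; have [Gf2 intf2 f2E] := v2.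
have mG (f : T -> R) : (forall B, measurable B -> G (f @^-1` B)) -> measurable_fun setT f.
  by move=> Gf _ B mB; rewrite setTI; apply: G_measurable; exact: Gf.
have mf1 := mG _ Gf1; have mf2 := mG _ Gf2; have mh := mG _ Gh.
have neg0 (f : T -> R) A : measurable A -> cond_prob_version P G A f ->
    {ae P, forall w, f w = Num.max (f w) 0%R}.
  move=> mA v; exists [set w | (f w < 0)%R]; split.
  - have [Gf _ _] := v; apply: G_measurable.
    rewrite (_ : [set _ | _] = f @^-1` `]-oo, 0%R[%classic); first exact: Gf.
    by apply/seteqP; split=> w /=; rewrite in_itv.
  - exact: cond_prob_version_ge0 v.
  - by move=> w /= fw; rewrite ltNge; apply: contra_notN fw => fw; rewrite max_l.
pose g1 w := Num.max (f1 w) 0%R; pose g2 w := Num.max (f2 w) 0%R.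
have mg1 : measurable_fun setT g1 by exact: measurable_maxr.
have mg2 : measurable_fun setT g2 by exact: measurable_maxr.
have ae1 := neg0 _ _ mA1 v1; have ae2 := neg0 _ _ mA2 v2.
have gE (f : T -> R) (C : set T) : measurable C -> measurable_fun setT f ->
    {ae P, forall w, f w = Num.max (f w) 0%R} ->
    \int[P]_(w in C) (Num.max (f w) 0%R)%:E = \int[P]_(w in C) (f w)%:E.
  move=> mC mf ae; apply: ae_eq_integral => //.
  - by apply/measurable_EFinP; apply: measurable_funTS; exact: measurable_maxr.
  - by apply/measurable_EFinP; exact: measurable_funTS.
  - by apply: filterS ae => w <-.
transitivity (\int[P]_w ((g2 w)%:E * (g1 w)%:E)).
  rewrite -(setIT (A1 `&` A2)) -f12E//; apply: ae_eq_integral => //.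
  - by apply/measurable_EFinP; exact: measurable_funM.
  - by apply/measurable_EFinP; exact: measurable_funM.
  - apply: filterS2 ae1 ae2 => w e1 e2 _; rewrite -EFinM [in LHS]e1 [in LHS]e2.
    by rewrite mulrC.
(* The same set carrying only [G]: agreement of integrals over the sets of [G] becomes agreement
   over all measurable sets of [GT']. *)
pose GT' := g_sigma_algebraType G.
have toG A : measurable (A : set GT') -> G A.
  by move=> mA; apply: (@smallest_sub _ _ G G G_sigma _ _ mA).
have mid : measurable_fun setT (id : T -> GT').
  by move=> _ B mB; rewrite setTI; apply: G_measurable; exact: toG.
have mGT (f : T -> R) : (forall B, measurable B -> G (f @^-1` B)) ->
    measurable_fun setT (f : GT' -> R).
  by move=> Gf _ B mB; rewrite setTI; apply: sub_sigma_algebra; exact: Gf.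
have mi : measurable_fun setT (\1_A2 : T -> R) by exact: measurable_indic.
transitivity (\int[P]_w ((g2 w)%:E * (h w)%:E)).
  apply: (@eq_weighted_integral _ GT' R _ _ _ _ P P id id g1 h mid mid _ _ _ _ _
    (EFin \o g2)) => //.
  - by move=> w; rewrite le_max lexx orbT.
  - by move=> A /toG GA; rewrite gE//; [rewrite f1E// hE|exact: G_measurable].
  - by apply/measurable_EFinP; apply: measurable_maxr => //; exact: mGT.
  - by move=> w; rewrite lee_fin le_max lexx orbT.
transitivity (\int[P]_w ((h w)%:E * (g2 w)%:E)).
  by apply: eq_integral => w _; rewrite muleC.
transitivity (\int[P]_w ((h w)%:E * (\1_A2 w)%:E)).
  apply: (@eq_weighted_integral _ GT' R _ _ _ _ P P id id g2 \1_A2 mid mid _ _ _ _ _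
    (EFin \o h)) => //.
  - by move=> w; rewrite le_max lexx orbT.
  - move=> A /toG GA; rewrite gE//; last exact: G_measurable.
    by rewrite f2E// integral_indic//; exact: G_measurable.
  - by apply/measurable_EFinP; exact: mGT.
by rewrite [RHS]integral_mkcond epatch_indic.
Qed.

End conditional_independence.

(** * Copies of a Markov process *)

Lemma integral_proportional_law d1 (T1 : measurableType d1) d2 (T2 : measurableType d2)
    (R : realType) (m : {measure set T1 -> \bar R}) (rho : {measure set T2 -> \bar R})
    (p : T1 -> T2) (B : set T1) (c : R) (f : T2 -> \bar R) :
  measurable_fun setT p -> measurable B -> (0 <= c)%R ->
  (forall A, measurable A -> m (B `&` p @^-1` A) = c%:E * rho A) ->
  measurable_fun setT f -> (forall x, 0 <= f x) ->
  \int[m]_(x in B) f (p x) = c%:E * \int[rho]_x f x.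
Proof.
move=> mp mB c0 mE mf f0.
rewrite integral_mkcond epatch_indic/=.
rewrite -ge0_integralZl//; under [RHS]eq_integral do rewrite muleC.
apply: (@eq_weighted_integral _ T2 R _ _ _ _ m rho p id \1_B (cst c)) => //.
move=> A mA; rewrite integral_indic//; last by rewrite -[X in measurable X]setTI; exact: mp.
by rewrite mE// -(integral_cst rho mA).
Qed.

Section markov_process.
Context d (W : measurableType d) (R : realType) (k : time_kind)
  (E : pseudoPMetricType R).
Variables (X : {mfun W >-> path_space k E}) (P : R.-pker (borel E) ~> W).
Hypothesis X_start : starts_at_point X P.

Let mX : measurable_fun setT (X : W -> path_space k E).
Proof. exact: measurable_funPT. Qed.

Lemma measurable_preimage_path d1 (W1 : measurableType d1) (Y : W1 -> path_space k E)
    (C : set (path_space k E)) :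
  measurable_fun setT Y -> measurable C -> measurable (Y @^-1` C).
Proof. by move=> mY mC; rewrite -[X in measurable X]setTI; exact: mY. Qed.

(** Under [P x] the starting point is almost surely [x], so the event on [X w 0] is almost surely
    everything or nothing. *)
Lemma kernel_start x (B : set W) (A : set (borel E)) : measurable B -> measurable A ->
  P x (B `&` [set w | A (X w 0%R)]) = (\1_A x)%:E * P x B.
Proof.
move=> mB mA.
have mA0 (A' : set (borel E)) : measurable A' -> measurable [set w | A' (X w 0%R)].
  by apply: measurable_process_at => //; exact: times0.
have [xA|xA] := boolP (x \in A).
  rewrite indicE xA mul1e; apply/esym.
  apply: (@eq_measure_mod_null _ _ _ _ _ _ [set w | (~` A) (X w 0%R)]) => //.
  - by apply: measurableI => //; exact: mA0.
  - by apply: mA0; exact: measurableC.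
  - by rewrite (X_start x (measurableC mA)) diracE in_setC xA.
  - by move=> w /= /contrapT Aw; split=> [|[]].
rewrite indicE (negbTE xA) mul0e.
apply: (@subset_measure0 _ _ _ _ _ [set w | A (X w 0%R)]) => //.
- by apply: measurableI => //; exact: mA0.
- exact: mA0.
- by apply: etrans (X_start x mA) _; rewrite diracE (negbTE xA).
Qed.

Lemma mixture_start (mu : probability (borel E) R) (A : set (borel E)) :
  measurable A -> mixture P mu [set w | A (X w 0%R)] = mu A.
Proof.
move=> mA; rewrite /mixture.
under eq_integral do rewrite X_start//.
by rewrite -[LHS]/(\int[mu]_x (\1_A x)%:E) integral_indic// setIT.
Qed.

Section copy.
Context d' (W' : measurableType d') (Q : probability W' R)
  (Y : W' -> path_space k E) (T : W -> \bar R) (S : W' -> \bar R).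
Hypotheses (mY : measurable_fun setT Y) (YS_copy : is_copy X P T Q Y S).

Let start : W' -> borel E := fun w => Y w 0%R.

Let mstart : measurable_fun setT start.
Proof.
move=> _ A mA; rewrite setTI.
by apply: (measurable_process_at mY) => //; exact: times0.
Qed.

Lemma copy_integral_start (A : set (borel E)) (C : set (path_space k E)) :
  measurable A -> measurable C ->
  \int[Q]_(w in start @^-1` A) P (start w) (X @^-1` C) =
  Q (Y @^-1` C `&` start @^-1` A).
Proof.
move=> mA mC; have [mu copyE] := YS_copy.
have copy_path (D : set (path_space k E)) : measurable D ->
    Q (Y @^-1` D) = mixture P mu (X @^-1` D).
  move=> mD; have := copyE (D `*` setT) (measurableX mD measurableT).
  rewrite (_ : [set w | _] = Y @^-1` D); last by apply/seteqP; split=> w //= [].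
  by move=> ->; congr (mixture P mu _); apply/seteqP; split=> w //= [].
have mCA : measurable (C `&` [set y : path_space k E | A (y 0%R)]).
  by apply: measurableI => //; apply: measurable_coordinate => //; exact: times0.
have mXC := measurable_preimage_path mX mC.
rewrite -[RHS]/(Q (Y @^-1` (C `&` [set y | A (y 0%R)]))) copy_path//.
rewrite -[RHS]/(\int[mu]_x P x (X @^-1` C `&` [set w | A (X w 0%R)])).
under [RHS]eq_integral do rewrite kernel_start// muleC.
rewrite (integral_mkcond (_ @^-1` A)) epatch_indic/=.
apply: (@eq_weighted_integral _ (borel E) R _ _ _ _ Q mu start id (\1_(start @^-1` A)) \1_A
  _ _ _ _ _ _ _ (fun x => P x (X @^-1` C))) => //.
- by apply: measurable_indic; rewrite -[X in measurable X]setTI; exact: mstart.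
- move=> B mB; rewrite !integral_indic//; last 2 first.
  + by rewrite -[X in measurable X]setTI; exact: mstart.
  + by rewrite -[X in measurable X]setTI; exact: mstart.
  have := copy_path [set y | (A `&` B) (y 0%R)].
  rewrite mixture_start//; last exact: measurableI.
  by apply; apply: measurable_coordinate; [exact: times0|exact: measurableI].
- exact: measurable_kernel.
Qed.

(** Given its starting point, [Y] ignores [B], so [B] influences [Y] only through the law of the
    starting point on [B], which is [rho] up to the factor [c]. *)
Lemma copy_cond_law (F : set (set W')) (B : set W') (c : R)
    (rho : probability (borel E) R) (C : set (path_space k E)) :
  cond_independent Q (preimage_set_system setT start measurable)
    (preimage_set_system setT Y measurable) F ->
  F B -> measurable B -> (0 <= c)%R ->
  (forall A, measurable A -> Q (B `&` start @^-1` A) = c%:E * rho A) ->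
  measurable C -> Q (B `&` Y @^-1` C) = c%:E * mixture P rho (X @^-1` C).
Proof.
move=> ci FB mB c0 QB mC.
have mXC := measurable_preimage_path mX mC.
have mK : measurable_fun setT (fun x => P x (X @^-1` C)) by exact: measurable_kernel.
have Kfin x : P x (X @^-1` C) \is a fin_num.
  rewrite ge0_fin_numE// (@le_lt_trans _ _ 1)// ?ltry// -(prob_kernel x (s := P)).
  by apply: le_measure => //; rewrite inE.
have mh : measurable_fun setT (fun x => fine (P x (X @^-1` C))).
  by apply: measurableT_comp => //; exact: mK.
rewrite setIC (@cond_independent_integral _ _ _ Q
  (preimage_set_system setT start measurable) _ _ (preimage_set_system setT Y measurable) F _ _
  (fun w => fine (P (start w) (X @^-1` C))))//.
- under eq_integral do rewrite fineK//.
  exact: (integral_proportional_law mstart).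
- apply: sigma_algebra_preimage; exact: sigma_algebra_measurable.
- by move=> _ [A mA <-]; exact: mstart.
- by exists C => //; rewrite setTI.
- exact: measurable_preimage_path.
- move=> A mA; exists ((fun x => fine (P x (X @^-1` C))) @^-1` A); last by rewrite setTI.
  by rewrite -[X in measurable X]setTI; exact: mh.
- move=> _ [A mA <-]; rewrite setTI.
  by under eq_integral do rewrite fineK//; exact: copy_integral_start.
Qed.

End copy.

End markov_process.

(** * Survival under the quasi-stationary distribution *)

Lemma measurable_path_map (R : realType) (k : time_kind) (E : pseudoPMetricType R)
    (r : R -> R) : (forall t, times R k t -> times R k (r t)) ->
  measurable_fun setT (fun y : path_space k E => (y \o r : path_space k E)).
Proof.
move=> rk; apply: (@measurability _ _ _ (path_space k E) _ _ (cylinders k E)) => // _ [_ [t kt [A mA ->]] <-].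
by rewrite setTI; apply: measurable_coordinate => //; exact: rk.
Qed.

Section survival.
Context d (W : measurableType d) (R : realType) (k : time_kind)
  (E : pseudoPMetricType R).
Variables (X : {mfun W >-> path_space k E}) (P : R.-pker (borel E) ~> W).
Hypothesis X_markov : cadlag_strong_markov_process X P.
Variables (U : set E) (T : {mfun W >-> \bar R}) (rho : probability (borel E) R).
Hypotheses (U_open : open U) (T_exit : forall w, T w = exit_time k U (X w)).
Hypothesis rho_qsd : is_qsd X P U T rho.

Let mX : measurable_fun setT (X : W -> path_space k E).
Proof. exact: measurable_funPT. Qed.

Let X_cadlag w : cadlag k (X w : R -> E).
Proof. by have [_ + _ _] := X_markov; exact. Qed.

Let mU : measurable (U : set (borel E)).
Proof. exact: sub_sigma_algebra. Qed.

Lemma measurable_gt d1 (W1 : measurableType d1) (S : W1 -> \bar R) (x : \bar R) :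
  measurable_fun setT S -> measurable [set w | x < S w].
Proof. by move=> mS; rewrite -[X in measurable X]setTI; exact: emeasurable_fun_o_infty. Qed.

Let mT : measurable_fun setT (T : W -> \bar R).
Proof. exact: measurable_funPT. Qed.

Definition survival (t : R) : R := fine (mixture P rho [set w | t%:E < T w]).

Lemma survivalE t : (survival t)%:E = mixture P rho [set w | t%:E < T w].
Proof. by rewrite /survival fineK// fin_num_measure//; exact: measurable_gt. Qed.

Lemma survival_ge0 t : (0 <= survival t)%R.
Proof. by rewrite -lee_fin survivalE. Qed.

Lemma survival_le1 t : (survival t <= 1)%R.
Proof. by rewrite -lee_fin survivalE probability_le1//; exact: measurable_gt. Qed.

(** Otherwise the conditional probability in the quasi-stationarity identity would be [0] by the
    convention on division, while for the event [U] it is [rho U = 1]. *)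
Lemma survival_gt0 t : times R k t -> (0 < survival t)%R.
Proof.
move=> kt; rewrite lt_neqAle survival_ge0 andbT eq_sym; apply/negP => /eqP F0.
have [rhoU /(_ t U kt mU (@subset_refl _ _))] := rho_qsd.
rewrite /cond_prob -/(survival t) F0 invr0 mulr0 rhoU => /eqP.
by rewrite /= oner_eq0.
Qed.

(** Quasi-stationarity speaks of subsets of [U] only. It extends to [A] because the path is in [U]
    before its exit and [rho] does not charge the complement of [U]. *)
Lemma qsd_law t (A : set (borel E)) : times R k t -> measurable A ->
  mixture P rho ([set w | t%:E < T w] `&` [set w | A (X w t)]) = (survival t)%:E * rho A.
Proof.
move=> kt mA.
have mAU : measurable (A `&` U) by exact: measurableI.
have [rhoU qsd] := rho_qsd.
have rhoUC : rho (~` U) = 0 by rewrite probability_setC// rhoU subee.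
have -> : rho A = rho (A `&` U).
  apply: (eq_measure_mod_null mA mAU (measurableC mU) rhoUC) => x /contrapT Ux.
  by split=> [|[]].
have mE : measurable [set w | (A `&` U) (X w t)] by exact: measurable_process_at.
have mTt : measurable [set w | t%:E < T w] by exact: measurable_gt.
have -> : [set w | t%:E < T w] `&` [set w | A (X w t)] =
          [set w | (A `&` U) (X w t)] `&` [set w | t%:E < T w].
  rewrite setIC; apply/seteqP; split=> w /= [Aw tw]; split=> //; last by have [] := Aw.
  split=> //; move: tw; rewrite T_exit => /(lt_exit_timeP U_open (X_cadlag w) kt).
  exact.
have := qsd t (A `&` U) kt mAU (@subIsetr _ _ _).
rewrite /cond_prob -/(survival t) => /(congr1 (fun r => r * survival t)%R).
rewrite divfK; last by rewrite gt_eqF// survival_gt0.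
move=> h; rewrite -[LHS]fineK; last by apply: fin_num_measure; exact: measurableI.
rewrite -h EFinM muleC; congr (_ * _).
by apply: fineK; exact: fin_num_measure.
Qed.

Lemma natural_filtration_sigma t : sigma_algebra setT (natural_filtration X t).
Proof. exact: smallest_sigma_algebra. Qed.

Lemma natural_filtration_stop (tau : R) (C : set (path_space k E)) : times R k tau ->
  measurable C -> natural_filtration X tau [set w | C (stop_path tau (X w))].
Proof.
move=> ktau; rewrite /natural_filtration; set gen := (G in <<s G >>).
have := smallest_sub (C := sigma_algebra setT) (G := cylinders k E)
  (X := [set C | <<s gen >> [set w | C (stop_path tau (X w))]]); apply.
  have [G0 GC GU] : sigma_algebra setT <<s gen >> by exact: smallest_sigma_algebra.
  split => /=.
  - exact: G0.
  - by move=> A hA; exact: (GC _ hA).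
  - by move=> A hA; exact: (GU _ hA).
move=> _ [t kt [A mA ->]] /=.
apply: sub_sigma_algebra; exists (Num.min t tau); last by exists A.
by split; [exact: times_min|rewrite ge_min lexx orbT].
Qed.

(** The strong Markov property wants an event of the past of [tau]. Such an event is obtained from a
    measurable version of the exit time of the stopped path, which exceeds [tau] exactly when that
    of the full path does. *)
Lemma survival_event (tau : R) : times R k tau ->
  exists B N : set W, [/\ natural_filtration X tau B, measurable N,
    mixture P rho N = 0 & forall w, ~ N w -> B w <-> tau%:E < T w].
Proof.
move=> ktau; pose Y w : path_space k E := stop_path tau (X w).
have mY : measurable_fun setT Y.
  apply: (measurableT_comp _ mX); apply: (measurable_path_map (r := fun t => Num.min t tau)).
  by move=> t kt; exact: times_min.
have [phi mphi [N [mN N0 phiE]]] := debut (mixture P rho) U_open mY.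
exists (Y @^-1` [set y | tau%:E < phi y]), (Y @^-1` N); split => //.
- by apply: (natural_filtration_stop ktau (C := [set y | tau%:E < phi y])); exact: measurable_gt.
- exact: measurable_preimage_path.
- move=> w /= wN; rewrite phiE//; last by apply: cadlag_stop => //; exact: X_cadlag.
  rewrite T_exit; apply: lt_exit_time_stop => //; exact: X_cadlag.
Qed.

Lemma natural_filtrationS s t : (s <= t)%R ->
  natural_filtration X s `<=` natural_filtration X t.
Proof.
move=> st; apply: smallest_sub; first exact: smallest_sigma_algebra.
move=> _ [u [ku us] [A mA ->]]; apply: sub_sigma_algebra; exists u.
  by split=> //; exact: le_trans us st.
by exists A.
Qed.

Lemma natural_filtration_measurable t : natural_filtration X t `<=` measurable.
Proof.
apply: smallest_sub; first exact: sigma_algebra_measurable.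
by move=> _ [u [ku us] [A mA ->]]; exact: measurable_process_at.
Qed.

Lemma measurable_shifted s (C : set (path_space k E)) : times R k s -> measurable C ->
  measurable [set w | C (Defs.shift s (X w))].
Proof.
move=> ks mC; have hs t : times R k t -> times R k (s + t)%R by exact: timesD.
rewrite -[X in measurable X]setTI.
exact: (measurableT_comp (measurable_path_map (E := E) hs) mX).
Qed.

(* The strong Markov property at the deterministic time s, the law of X(s) given
   survival being rho. *)
Lemma qsd_shift s (C : set (path_space k E)) : times R k s -> measurable C ->
  mixture P rho ([set w | s%:E < T w] `&` [set w | C (Defs.shift s (X w))]) =
  (survival s)%:E * mixture P rho (X @^-1` C).
Proof.
move=> ks mC; have [X_start _ _ X_strong] := X_markov.
have [B [N [FB mN N0 BT]]] := survival_event ks.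
have mB := natural_filtration_measurable FB.
have mTs : measurable [set w | s%:E < T w] by exact: measurable_gt.
have mshift := measurable_shifted ks mC.
transitivity (mixture P rho (B `&` [set w | C (Defs.shift s (X w))])).
  apply: (eq_measure_mod_null _ _ mN N0); [exact: measurableI..|].
  by move=> w /BT wE; split=> -[/= /wE].
have mK : measurable_fun setT (fun x => P x (X @^-1` C)).
  by apply: measurable_kernel; exact: measurable_preimage_path.
have mXs : measurable_fun setT (fun w => X w s : borel E).
  by move=> _ A mA; rewrite setTI; exact: measurable_process_at.
transitivity (\int[mixture P rho]_(w in B) P (X w s) (X @^-1` C)).
  rewrite [RHS]integral_mkcond epatch_indic integral_mixture; last 2 first.
  - apply: emeasurable_funM; first exact: (measurableT_comp mK mXs).
    by apply/measurable_EFinP; exact: measurable_indic.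
  - by move=> w; rewrite mule_ge0// lee_fin.
  apply: eq_integral => x _; rewrite -epatch_indic -integral_mkcond.
  (* For a constant time the event of having stopped by [t] is everything or empty. *)
  have st : stopping_time X (fun=> s%:E).
    split=> [w|t kt]; first by right; exists s.
    have [st|ts] := leP s t.
      rewrite (_ : [set w | _] = setT).
        by rewrite -(setD0 setT); have [G0 GC _] := natural_filtration_sigma t; apply: GC; exact: G0.
      by apply/seteqP; split=> // w _ /=; rewrite lee_fin.
    rewrite (_ : [set w | _] = set0).
      by have [G0 _ _] := natural_filtration_sigma t; exact: G0.
    by apply/seteqP; split=> // w /=; rewrite lee_fin leNgt ts.
  have sB : stopped_events X (fun=> s%:E) B.
    split=> // t kt; have [st'|ts] := leP s t.
      rewrite (_ : _ `&` _ = B); first exact: natural_filtrationS st' _ FB.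
      by apply/seteqP; split=> [w []//|w Bw]; split=> //=; rewrite lee_fin.
    rewrite (_ : _ `&` _ = set0).
      by have [G0 _ _] := natural_filtration_sigma t; exact: G0.
    by apply/seteqP; split=> // w [_] /=; rewrite lee_fin leNgt ts.
  have := X_strong x _ B C st sB mC.
  rewrite (_ : B `&` [set w | _] = B)//.
  by apply/seteqP; split=> [w []//|w Bw]; split=> //=; exact: ltry.
rewrite -[RHS]/((survival s)%:E * \int[rho]_x P x (X @^-1` C)).
apply: (integral_proportional_law mXs mB (survival_ge0 s)) => // A mA.
rewrite -qsd_law//; apply: (eq_measure_mod_null _ _ mN N0).
- by apply: measurableI => //; rewrite -[X in measurable X]setTI; exact: mXs.
- by apply: measurableI => //; exact: measurable_process_at.
- by move=> w /BT wE; split=> -[/= /wE].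
Qed.

(** Surviving [s + t] means surviving [s] and then, for the shifted path, surviving [t]; the second
    event is replaced by one about [phi], to which [qsd_shift] applies. *)
Lemma survivalD s t : times R k s -> times R k t ->
  survival (s + t) = (survival s * survival t)%R.
Proof.
move=> ks kt; apply: EFin_inj; rewrite EFinM !survivalE.
have [phi mphi [N [mN N0 phiE]]] := debut (mixture P rho) U_open mX.
have mC : measurable [set y | t%:E < phi y] by exact: measurable_gt.
have mTs : measurable [set w | s%:E < T w] by exact: measurable_gt.
have -> : mixture P rho [set w | t%:E < T w] = mixture P rho (X @^-1` [set y | t%:E < phi y]).
  apply: (eq_measure_mod_null _ _ _ N0).
  - exact: measurable_gt.
  - exact: measurable_preimage_path.
  - exact: measurable_preimage_path.
  - by move=> w wN; rewrite /= phiE// T_exit.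
rewrite -(survivalE s) -qsd_shift//.
(* The exceptional set of [phi] must also be negligible for the shifted path. On survival up to [s]
   this is [qsd_shift] again, applied to [N]. *)
have N0' : mixture P rho ([set w | s%:E < T w] `&` [set w | N (Defs.shift s (X w))]) = 0.
  by rewrite qsd_shift// N0 mule0.
apply: (eq_measure_mod_null _ _ _ N0').
- exact: measurable_gt.
- by apply: measurableI => //; exact: measurable_shifted.
- by apply: measurableI => //; exact: measurable_shifted.
- move=> w wN /=; rewrite T_exit lt_exit_timeD//.
  have cs := cadlag_shift ks (X_cadlag w).
  split=> -[sw tw]; split => //; [rewrite phiE//|rewrite -phiE//];
    by move=> Nw; apply: wN; split=> //=; rewrite T_exit.
Qed.

End survival.

(** * Survival of the successive copies *)

Section copies.
Context d (W : measurableType d) (R : realType) (k : time_kind)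
  (E : pseudoPMetricType R).
Variables (X : {mfun W >-> path_space k E}) (P : R.-pker (borel E) ~> W).
Hypothesis X_markov : cadlag_strong_markov_process X P.
Variables (U : set E) (T : {mfun W >-> \bar R}) (rho : probability (borel E) R).
Hypotheses (U_open : open U) (T_exit : forall w, T w = exit_time k U (X w)).

Let mX : measurable_fun setT (X : W -> path_space k E).
Proof. exact: measurable_funPT. Qed.

Let mT : measurable_fun setT (T : W -> \bar R).
Proof. exact: measurable_funPT. Qed.

Let X_cadlag w : cadlag k (X w : R -> E).
Proof. by have [_ + _ _] := X_markov; exact. Qed.

Section one_copy.
Context d' (W' : measurableType d') (Q : probability W' R)
  (Y : W' -> path_space k E) (S : W' -> \bar R).
Hypotheses (mY : measurable_fun setT Y) (mS : measurable_fun setT S).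
Hypothesis YS_copy : is_copy X P T Q Y S.

(* The lifetime of a copy is only given through its joint law with the path, but
   it is a.s. a measurable function of the path. *)
Lemma copy_lifetime : exists (phi : path_space k E -> \bar R) (N : set (path_space k E)),
  [/\ measurable_fun setT phi, measurable N, Q (Y @^-1` N) = 0,
      forall y, cadlag k (y : R -> E) -> ~ N y -> phi y = exit_time k U y &
      forall t : \bar R, exists M : set W', [/\ measurable M, Q M = 0 &
        forall w, ~ M w -> t < phi (Y w) <-> t < S w]].
Proof.
have [mu copyE] := YS_copy.
have [phi mphi [N [mN N0 phiE]]] := debut (mixture P mu) U_open mX.
exists phi, N; split => //.
  have := copyE (N `*` setT) (measurableX mN measurableT).
  rewrite (_ : [set w | _] = Y @^-1` N); last by apply/seteqP; split=> w //= [].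
  move=> ->; rewrite -N0; congr (mixture P mu _).
  by apply/seteqP; split=> w //= [].
move=> t; pose A := [set y : path_space k E | t < phi y].
have mA : measurable A by exact: measurable_gt.
have mgt : measurable [set s : \bar R | t < s] by exact: (measurable_gt (S := id)).
(* The disagreement of [phi] and the lifetime about exceeding [t], as a measurable set of pairs, so
   that its probability can be computed for [(X, T)], where it is contained in the null event of
   [N]. *)
pose D : set (path_space k E * \bar R) :=
  (A `*` (~` [set s : \bar R | t < s])) `|` ((~` A) `*` [set s : \bar R | t < s]).
have mD : measurable D.
  by apply: measurableU; apply: measurableX => //; exact: measurableC.
exists [set w | D (Y w, S w)]; split.
- have mYS : measurable_fun setT (fun w => (Y w, S w)) by exact/measurable_fun_pair.
  by rewrite -[X in measurable X]setTI; exact: mYS.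
- rewrite copyE//; apply: (@subset_measure0 _ _ _ _ _ (X @^-1` N)) => //.
  + have mXT : measurable_fun setT (fun w => (X w : path_space k E, T w)) by exact/measurable_fun_pair.
    by rewrite -[X in measurable X]setTI; exact: mXT.
  + exact: measurable_preimage_path.
  + move=> w /= DXT; apply: contrapT => /(phiE _ (X_cadlag w)) E'.
    by case: DXT => -[/=]; rewrite /A/= E' -T_exit.
- move=> w /= nD; split=> h; apply: contrapT => nh; apply: nD; [left|right]; by split.
Qed.

(** [A] is the event of interest and [B] a version of it in [F], up to the null set [M]; likewise
    [S] is replaced by [phi] of the path. All events then concern paths, as conditional independence
    demands. *)
Lemma copy_survival (F : set (set W')) (A B M : set W') (c : R) t (C : set (path_space k E)) :
  cond_independent Q
    (preimage_set_system setT (fun w => Y w 0%R : borel E) measurable)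
    (preimage_set_system setT Y measurable) F ->
  F B -> measurable A -> measurable B -> measurable M -> Q M = 0 ->
  (forall w, ~ M w -> A w <-> B w) -> (0 < c)%R ->
  (forall D : set (borel E), measurable D -> Q (A `&` [set w | D (Y w 0%R)]) = c%:E * rho D) ->
  measurable C ->
  Q (A `&` [set w | t < S w] `&` Y @^-1` C) =
  c%:E * mixture P rho ([set w | t < T w] `&` X @^-1` C).
Proof.
move=> ci FB mA mB mM M0 AB c0 QA mC.
have [X_start _ _ _] := X_markov.
have [phi [N [mphi mN N0 phiE /(_ t)[M' [mM' M'0 phiS]]]]] := copy_lifetime.
have mMM : measurable (M `|` M') by exact: measurableU.
have MM0 : Q (M `|` M') = 0 by exact: null_set_setU.
have mY0 (D : set (borel E)) : measurable D -> measurable [set w | D (Y w 0%R)].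
  by move=> mD; exact: (measurable_process_at mY (times0 R k) mD).
have law D : measurable D -> Q (B `&` Y @^-1` D) = c%:E * mixture P rho (X @^-1` D).
  move=> mD; apply: (copy_cond_law X_start mY YS_copy ci) => //; first exact: ltW.
  move=> D' mD'; rewrite -QA//; apply: (eq_measure_mod_null _ _ mM M0).
  - by apply: measurableI => //; exact: mY0.
  - by apply: measurableI => //; exact: mY0.
  - by move=> w /AB wE; split=> -[/= /wE].
have mgt : measurable [set y | t < phi y] by exact: measurable_gt.
(* [N] is null for the law of the copy, whose initial law need not be [rho]. As [c] is positive, the
   law on [B] passes this on to [P_rho]. *)
have XN0 : mixture P rho (X @^-1` N) = 0.
  have : c%:E * mixture P rho (X @^-1` N) = 0.
    rewrite -law//; apply: (@subset_measure0 _ _ _ _ _ (Y @^-1` N)) => //.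
    + by apply: measurableI => //; exact: measurable_preimage_path.
    + exact: measurable_preimage_path.
  by move/eqP; rewrite mule_eq0 eqe gt_eqF//= => /eqP.
transitivity (Q (B `&` Y @^-1` ([set y | t < phi y] `&` C))).
  apply: (eq_measure_mod_null _ _ mMM MM0).
  - apply: measurableI; last exact: measurable_preimage_path.
    by apply: measurableI => //; exact: measurable_gt.
  - by apply: measurableI => //; apply: measurable_preimage_path => //; exact: measurableI.
  - move=> w /not_orP[/AB wE /phiS wE']; split.
      by move=> [[/= /wE Bw /wE' tw] Cw]; split.
    by move=> [/= /wE Aw [/wE' tw Cw]]; split.
rewrite law; last exact: measurableI.
congr (_ * _); apply: (eq_measure_mod_null _ _ _ XN0).
- by apply: measurable_preimage_path => //; exact: measurableI.
- by apply: measurableI; [exact: measurable_gt|exact: measurable_preimage_path].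
- exact: measurable_preimage_path.
- by move=> w /= /(phiE _ (X_cadlag w)) wE; rewrite wE -T_exit.
Qed.

End one_copy.

Context d' (W' : measurableType d') (Q : probability W' R)
  (X_ : nat -> {mfun W' >-> path_space k E}) (T_ : nat -> {mfun W' >-> \bar R}).
Hypothesis XT_copy : forall m, (1 <= m)%N -> is_copy X P T Q (X_ m) (T_ m).
Variable t_ : nat -> R.
Hypothesis hyp_a : forall m, (1 <= m)%N ->
  cond_independent Q
    (preimage_set_system setT (fun w => X_ m w 0%R : borel E) measurable)
    (preimage_set_system setT (X_ m) measurable)
    (past X_ m).
Hypothesis hyp_b1 : forall A : set (borel E), measurable A ->
  Q [set w | A (X_ 1%N w 0%R)] = rho A.
Hypothesis hyp_b : forall m, (2 <= m)%N -> forall A : set (borel E), measurable A ->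
  cond_prob Q
    [set w | forall j, (1 <= j < m)%N -> (t_ j)%:E < T_ j w]
    [set w | A (X_ m w 0%R)] = fine (rho A).

Definition alive m := [set w | forall j, (1 <= j < m)%N -> (t_ j)%:E < T_ j w].

Lemma aliveS m : (1 <= m)%N -> alive m.+1 = alive m `&` [set w | (t_ m)%:E < T_ m w].
Proof.
move=> m1; apply/seteqP; split=> w.
  move=> h; split=> [j /andP[j1 jm]|]; apply: h; first by rewrite j1 leqW.
  by rewrite m1 ltnSn.
move=> [h hm] j /andP[j1]; rewrite ltnS leq_eqVlt => /orP[/eqP ->//|jm].
by apply: h; rewrite j1.
Qed.

Lemma alive1 : alive 1 = setT.
Proof. by apply/seteqP; split=> // w _ [|j]. Qed.

Lemma measurable_alive m : (1 <= m)%N -> measurable (alive m).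
Proof.
elim: m => [//|[|m] IH _]; first by rewrite alive1.
rewrite aliveS//; apply: measurableI; first exact: IH.
by apply: measurable_gt; exact: measurable_funPT.
Qed.

(** The past is generated by paths alone; each lifetime is exchanged for its version [phi] of the
    path, and the null sets are collected in [M]. *)
Lemma alive_past m : (1 <= m)%N -> exists B M : set W',
  [/\ past X_ m B, measurable M, Q M = 0 & forall w, ~ M w -> alive m w <-> B w].
Proof.
have past_sigma n : sigma_algebra setT (past X_ n) by exact: smallest_sigma_algebra.
have pastS n : past X_ n `<=` past X_ n.+1.
  apply: smallest_sub; first exact: past_sigma.
  move=> A [j /= /andP[j1 jn] hA]; apply: sub_sigma_algebra; exists j => //=.
  by rewrite j1 leqW.
elim: m => [//|[|m] IH _].
  exists setT, set0; split => //; last by rewrite alive1.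
  by have [G0 GC _] := past_sigma 1%N; rewrite -(setD0 setT); exact: GC.
have [B [M [pB mM M0 MB]]] := IH isT.
have [phi [N [mphi mN N0 phiE /(_ (t_ m.+1)%:E)[M' [mM' M'0 phiS]]]]] :=
  copy_lifetime (measurable_funPT _) (measurable_funPT _) (XT_copy (ltn0Sn m)).
exists (B `&` X_ m.+1 @^-1` [set y | (t_ m.+1)%:E < phi y]), (M `|` M'); split.
- have pm : setI_closed (past X_ m.+2).
    by have [_ _ _] := (sigma_algebraP (fun A _ => @subsetT _ A)).1 (past_sigma m.+2).
  apply: pm; first exact: pastS.
  apply: sub_sigma_algebra; exists m.+1 => /=; first by rewrite ltnSn.
  by exists [set y | (t_ m.+1)%:E < phi y]; [exact: measurable_gt|rewrite setTI].
- exact: measurableU.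
- exact: null_set_setU.
- move=> w /not_orP[/MB wE /phiS wE']; rewrite aliveS//; split.
    by move=> [/wE Bw /= /wE' tw].
  by move=> [/wE Aw /= /wE' tw].
Qed.

Lemma past_measurable m : past X_ m `<=` measurable.
Proof.
apply: smallest_sub; first exact: sigma_algebra_measurable.
by move=> _ [j _ [A mA <-]]; rewrite setTI; apply: measurable_preimage_path => //; exact: measurable_funPT.
Qed.

Definition alive_prob m : R := fine (Q (alive m)).

Lemma alive_probE m : (1 <= m)%N -> (alive_prob m)%:E = Q (alive m).
Proof. by move=> m1; rewrite /alive_prob fineK// fin_num_measure//; exact: measurable_alive. Qed.

Lemma alive_start m : (1 <= m)%N -> (0 < alive_prob m)%R /\
  forall D : set (borel E), measurable D -> Q (alive m `&` [set w | D (X_ m w 0%R)]) =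
  (alive_prob m)%:E * rho D.
Proof.
move=> m1; have mD (D : set (borel E)) : measurable D -> measurable [set w | D (X_ m w 0%R)].
  by move=> mD; exact: (measurable_process_at (measurable_funPT (X_ m)) (times0 R k) mD).
move: m1; rewrite leq_eqVlt => /orP[/eqP<-|m2].
  rewrite /alive_prob alive1 probability_setT; split=> // D mD'.
  by rewrite setTI hyp_b1// mul1e.
have m1 := ltnW m2.
(* With a vanishing denominator, (b) for the whole space would read [0 = 1]. *)
have a0 : alive_prob m != 0%R.
  apply/eqP => a0; have := hyp_b m2 measurableT.
  rewrite /cond_prob -/(alive m) -/(alive_prob m) a0 invr0 mulr0 probability_setT => /eqP.
  by rewrite eq_sym oner_eq0.
split; first by rewrite lt_neqAle eq_sym a0 /= -lee_fin alive_probE.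
move=> D mD'; have := hyp_b m2 mD'.
rewrite /cond_prob -/(alive m) -/(alive_prob m) => /(congr1 (fun r => r * alive_prob m)%R).
rewrite divfK// => h; rewrite setIC -[LHS]fineK; last first.
  by apply: fin_num_measure; apply: measurableI; [exact: mD|exact: measurable_alive].
by rewrite h EFinM muleC; congr (_ * _); rewrite fineK// fin_num_measure.
Qed.

Lemma alive_survival m t (C : set (path_space k E)) : (1 <= m)%N -> measurable C ->
  Q (alive m `&` [set w | t < T_ m w] `&` X_ m @^-1` C) =
  (alive_prob m)%:E * mixture P rho ([set w | t < T w] `&` X @^-1` C).
Proof.
move=> m1 mC; have [a0 aD] := alive_start m1.
have [B [M [pB mM M0 MB]]] := alive_past m1.
apply: (copy_survival (measurable_funPT _) (measurable_funPT _) (XT_copy m1) t (hyp_a m1) pB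
  _ _ mM M0) => //.
- exact: measurable_alive.
- exact: past_measurable pB.
Qed.

Lemma alive_probS m : (1 <= m)%N ->
  alive_prob m.+1 = (alive_prob m * survival P T rho (t_ m))%R.
Proof.
move=> m1; apply: EFin_inj; rewrite EFinM survivalE alive_probE// aliveS//.
by have := alive_survival (t_ m)%:E m1 measurableT; rewrite !preimage_setT !setIT.
Qed.

End copies.

(** * Sums and integrals over time *)

Lemma lebesgue_measure_shift (R : realType) (s : R) (A : set R) : measurable A ->
  pushforward (@lebesgue_measure R) ((fun t => s + t)%R : _ -> measurableTypeR R) A =
  lebesgue_measure A.
Proof.
have ms : measurable_fun setT ((fun t => s + t)%R : measurableTypeR R -> measurableTypeR R).
  exact: measurable_funD.
pose ms_mixin := isMeasurableFun.Build _ _ _ _ _ ms.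
pose ms_pack : {mfun _ >-> _} := HB.pack ((fun t => s + t)%R : measurableTypeR R -> measurableTypeR R) ms_mixin.
move=> mA; apply/esym.
apply: (@lebesgue_measure_unique R (pushforward (@lebesgue_measure R) ms_pack)) => //= _ [[a b]] _ <-.
rewrite /pushforward (_ : _ @^-1` _ = `](a - s)%R, (b - s)%R]%classic).
  by rewrite !lebesgue_measure_itv/= !lte_fin ltrD2r -!EFinB opprB addrA subrK.
by apply/seteqP; split=> t /=; rewrite !in_itv/= ltrBlDl lerBrDl.
Qed.

Section time_integral.
Context (R : realType) (k : time_kind).
Implicit Types (f : R -> \bar R) (s t : R).

Definition time_integral f : \bar R :=
  match k with
  | Discrete => \sum_(0 <= n <oo) f n%:R
  | Defs.Continuous => \int[@lebesgue_measure R]_(t in [set t : R | (0 <= t)%R]) f t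
  end.

Lemma eq_time_integral f1 f2 : (forall t, times R k t -> f1 t = f2 t) ->
  time_integral f1 = time_integral f2.
Proof.
rewrite /time_integral /times; case: k => f12.
  by apply: eq_eseriesr => n _; apply: f12; exists n.
by apply: eq_integral => t; rewrite inE => t0; exact: f12.
Qed.

Lemma time_integral_ge0 f : (forall t, times R k t -> 0 <= f t) -> 0 <= time_integral f.
Proof.
rewrite /time_integral /times; case: k => f0.
  by apply: nneseries_ge0 => n _ _; apply: f0; exists n.
exact: integral_ge0.
Qed.

(** Moves the random bound [tau] from the domain into the integrand, so that Fubini applies over a
    fixed set of times. *)
Lemma total_overE (h : R -> R) (tau : \bar R) :
  total_over k h tau = time_integral (fun t => if t%:E < tau then (h t)%:E else 0).
Proof.
rewrite /total_over /time_integral; case: k; first by rewrite eseries_mkcond.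
rewrite (_ : [set t : R | _ /\ _] = [set t | (0 <= t)%R] `&` [set t | t%:E < tau])//.
rewrite integral_mkcondr; apply: eq_integral => t _; rewrite patchE.
by have [tt|tt] := boolP (t%:E < tau); [rewrite mem_set|rewrite memNset//; exact/negP].
Qed.

Lemma time_integralZ (c : R) f : (0 <= c)%R -> measurable_fun (times R k) f ->
  (forall t, times R k t -> 0 <= f t) ->
  time_integral (fun t => c%:E * f t) = c%:E * time_integral f.
Proof.
move: (measurable_times (R := R) k).
rewrite /time_integral /times; case: k => mD c0 mf f0.
  by apply: nneseriesZl => n _; apply: f0; exists n.
by rewrite ge0_integralZl.
Qed.

Lemma time_integral_series (u : nat -> R -> \bar R) :
  (forall n, measurable_fun (times R k) (u n)) ->
  (forall n t, times R k t -> 0 <= u n t) ->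
  time_integral (fun t => \sum_(0 <= n <oo) u n t) =
  \sum_(0 <= n <oo) time_integral (u n).
Proof.
move: (measurable_times (R := R) k).
rewrite /time_integral /times; case: k => mD mu u0.
  have u0' n m : 0 <= u n m%:R by apply: u0; exists m.
  by rewrite nneseries_interchange.
by rewrite integral_nneseries.
Qed.

Lemma time_integral_shift s f : times R k s -> measurable_fun (times R k) f ->
  (forall t, times R k t -> 0 <= f t) ->
  time_integral (fun t => if (s <= t)%R then f t else 0) =
  time_integral (fun t => f (s + t)%R).
Proof.
move: (measurable_times (R := R) k).
rewrite /time_integral /times; case: k => /= mD ks mf f0.
  have [m _ <-] := ks.
  have f0' n : 0 <= f n%:R by apply: f0; exists n.
  rewrite (nneseries_split 0%N m); last by move=> n _; case: ifP.
  rewrite add0n big_nat_cond big1 ?add0e; last first.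
    by move=> n /andP[/andP[_ nm] _]; rewrite ler_nat leqNgt nm.
  rewrite -nneseries_addn; last by move=> n; case: ifP.
  by apply: eq_eseriesr => n _; rewrite ler_nat leq_addl natrD addrC.
have mDs : measurable [set t : R | (s <= t)%R].
  rewrite [X in measurable X](_ : _ = `[s, +oo[%classic); first exact: measurable_itv.
  by apply/seteqP; split => t /=; rewrite in_itv/= andbT.
have sD : [set t : R | (s <= t)%R] `<=` [set t | (0 <= t)%R] by move=> t /=; exact: le_trans.
transitivity (\int[@lebesgue_measure R]_(t in [set t | (s <= t)%R]) f t).
  rewrite -[in RHS](setIidr sD) integral_mkcondr; apply: eq_integral => t _.
  by rewrite patchE; have [st|st] := boolP (s <= t)%R; [rewrite mem_set|rewrite memNset//; apply/negP].
transitivity (\int[pushforward (@lebesgue_measure R) ((fun t => s + t)%R : _ -> measurableTypeR R)]_(t in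
    [set t : R | (s <= t)%R]) f t).
  apply: eq_measure_integral; first exact: measurable_funD.
  by move=> ms A mA _; exact: (esym (lebesgue_measure_shift s mA)).
rewrite ge0_integral_pushforward//.
- by congr (integral _ _ _); apply/seteqP; split=> t /=; rewrite lerDl.
- exact: measurable_funD.
- exact: measurable_funS mf.
- by move=> t; rewrite inE => st; apply: f0; exact: sD.
Qed.

Lemma le_time_integral f1 f2 : measurable_fun (times R k) f1 -> measurable_fun (times R k) f2 ->
  (forall t, times R k t -> 0 <= f1 t) -> (forall t, times R k t -> f1 t <= f2 t) ->
  time_integral f1 <= time_integral f2.
Proof.
move: (measurable_times (R := R) k).
rewrite /time_integral /times; case: k => mD mf1 mf2 f10 f12.
  by apply: lee_nneseries => n _; [move=> _; apply: f10|apply: f12]; exists n.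
by apply: ge0_le_integral => // t t0; exact: (le_trans (f10 _ t0) (f12 _ t0)).
Qed.

Lemma time_integral_lt_natr (n : nat) :
  time_integral (fun t => if (t < n%:R)%R then 1 else 0) = n%:R%:E.
Proof.
rewrite /time_integral; case: k => /=.
  rewrite (nneseries_split 0%N n); last by move=> m _; case: ifP.
  rewrite add0n eseries0 ?adde0; last first.
    by move=> m nm _; rewrite ltr_nat ltnNge nm.
  rewrite (eq_big_nat _ _ (F2 := fun=> 1%:E)).
    by rewrite sumEFin big_const_nat subn0 iter_addr_0.
  by move=> m /andP[_ mn]; rewrite ltr_nat mn.
transitivity (\int[@lebesgue_measure R]_(t in `[0%R, n%:R[%classic) (cst 1 t)).
  rewrite integral_mkcond [RHS]integral_mkcond; apply: eq_integral => t _.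
  rewrite !patchE; have -> : (t \in [set t : R | (0 <= t)%R]) = (0 <= t)%R.
    by apply/idP/idP => [/set_mem|/mem_set].
  rewrite mem_setE in_itv/=; by case: (0 <= t)%R.
rewrite integral_cst// mul1e /= lebesgue_measure_itv/= lte_fin.
by case: ltP => [_|]; [rewrite oppr0 adde0|rewrite lern0 => /eqP ->].
Qed.

Lemma time_integral_swap d (W : measurableType d) (Q : probability W R)
    (f : R * W -> \bar R) : measurable_fun (times R k `*` setT) f ->
  (forall p, 0 <= f p) ->
  \int[Q]_w time_integral (fun t => f (t, w)) =
  time_integral (fun t => \int[Q]_w f (t, w)).
Proof.
have mpair (t : R) : measurable_fun setT (fun w : W => (t, w)) by exact: measurable_pair1.
move: (measurable_times (R := R) k).
rewrite /time_integral /times; case: k => /= mD mf f0.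
  rewrite integral_nneseries// => n.
  apply: (measurable_comp _ _ mf (mpair _)); last by move=> _ [w _ <-]; split=> //; exists n.
  exact: measurableX.
(* Measurability of [f] is known for nonnegative times only, so [f] is extended by [0] before Fubini
   is used on the whole product. *)
pose D := [set t : R | (0 <= t)%R] `*` [set: W].
have mD' : measurable D by exact: measurableX.
have patchD t w : (f \_ D) (t, w) = ((fun t => f (t, w)) \_ [set t | (0 <= t)%R]) t.
  rewrite !patchE; suff -> : ((t, w) \in D) = (t \in [set t | (0 <= t)%R]) by [].
  by apply/idP/idP => [/set_mem[t0 _]|/set_mem t0]; apply: mem_set.
under eq_integral do rewrite integral_mkcond; under eq_integral.
  by move=> w _; under eq_integral do rewrite -patchD; over.
rewrite [RHS]integral_mkcond.
rewrite -(@sfinite_Fubini _ _ _ _ _ (@lebesgue_measure R) Q (f \_ D)).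
- apply: eq_integral => t _; rewrite patchE; case: ifPn => tD.
    by apply: eq_integral => w _; rewrite patchD patchE tD.
  by apply: integral0_eq => w _; rewrite patchD patchE (negbTE tD).
- by move=> p; rewrite patchE; case: ifP.
- by apply/(measurable_restrictT _ mD').
Qed.

Lemma measurable_time_integral d (W : measurableType d) (f : R * W -> \bar R) :
  measurable_fun (times R k `*` setT) f -> (forall p, 0 <= f p) ->
  measurable_fun setT (fun w => time_integral (fun t => f (t, w))).
Proof.
have mpair (t : R) : measurable_fun setT (fun w : W => (t, w)) by exact: measurable_pair1.
move: (measurable_times (R := R) k).
rewrite /time_integral /times; case: k => /= mD mf f0.
  have := @ge0_emeasurable_sum _ W R setT (fun n w => f (n%:R%R, w)) xpredT.
  apply => // n _; apply: (measurable_comp _ _ mf (mpair _)); last first.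
    by move=> _ [w _ <-]; split=> //; exists n.
  exact: measurableX.
pose D := [set t : R | (0 <= t)%R] `*` [set: W].
have mD' : measurable D by exact: measurableX.
have mfD : measurable_fun setT (f \_ D) by apply/(measurable_restrictT _ mD').
have fD0 p : 0 <= (f \_ D) p by rewrite patchE; case: ifP.
rewrite (_ : (fun w => _) = fun w => \int[@lebesgue_measure R]_t (f \_ D) (t, w)).
  exact: (measurable_fun_fubini_tonelli_G (m1 := @lebesgue_measure R)).
apply/funext => w; rewrite integral_mkcond; apply: eq_integral => t _.
rewrite !patchE; suff -> : ((t, w) \in D) = (t \in [set t | (0 <= t)%R]) by [].
by apply/idP/idP => [/set_mem[t0 _]|/set_mem t0]; apply: mem_set.
Qed.

End time_integral.

Section integral_total_over.
Context d (W : measurableType d) (R : realType) (k : time_kind)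
  (E : pseudoPMetricType R) (Q : probability W R).
Variables (Y : W -> path_space k E) (S : W -> \bar R) (B : set W) (a : \bar R).
Hypotheses (mY : measurable_fun setT Y) (Y_cadlag : forall w, cadlag k (Y w : R -> E)).
Hypotheses (mS : measurable_fun setT S) (mB : measurable B).
Variable h : borel E -> R.
Hypotheses (mh : measurable_fun setT h) (h0 : forall x, (0 <= h x)%R).

Let live : set (R * W) := [set p | [/\ B p.2, p.1%:E < S p.2 & p.1%:E < a]].

Let mlive : measurable live.
Proof.
have -> : live = (setT `*` B) `&` ([set p | p.1%:E < S p.2] `&` ([set t | t%:E < a] `*` setT)).
  by apply/seteqP; split=> [p [h1 h2 h3]|p [[_ h1] [h2 [h3 _]]]]; split.
have mfst : measurable_fun setT (fun p : R * W => p.1%:E).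
  by apply/measurable_EFinP; exact: measurable_fst.
apply: measurableI; first exact: measurableX.
apply: measurableI.
  rewrite (_ : [set p | _] = [set p | 0 < S p.2 - p.1%:E]); last first.
    by apply/seteqP; split=> p /=; rewrite EFinN lteBrDr// add0e.
  apply: measurable_gt; apply: emeasurable_funB => //.
  exact: measurableT_comp mS measurable_snd.
apply: measurableX => //; rewrite -[X in measurable X]setTI.
apply: emeasurable_fun_infty_o => //; exact: measurable_EFin.
Qed.

Let f (p : R * W) : \bar R := (h (Y p.2 p.1))%:E * (\1_live p)%:E.

Let mf : measurable_fun (times R k `*` setT) f.
Proof.
apply: emeasurable_funM.
  apply/measurable_EFinP.
  exact: (measurableT_comp mh (measurable_process mY Y_cadlag)).
by apply/measurable_EFinP; apply: measurable_funTS; exact: measurable_indic.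
Qed.

Let f0 p : 0 <= f p.
Proof. by rewrite mule_ge0// lee_fin. Qed.

Lemma total_over_patch w :
  ((fun w => total_over k (fun t => h (Y w t)) (Order.min (S w) a)) \_ B) w =
  time_integral k (fun t => f (t, w)).
Proof.
rewrite patchE; case: ifPn => wB.
  rewrite total_overE; apply: eq_time_integral => t _.
  rewrite /f/= indicE lt_min; case: ifPn => [/andP[tS ta]|tn].
    by rewrite mem_set ?mule1//; split=> //; exact: set_mem.
  rewrite memNset ?mule0// => -[_ /= tS ta]; move: tn.
  by rewrite tS ta.
(* Zero is written as a product so that [time_integralZ] covers both kinds of time. *)
rewrite (@eq_time_integral _ _ _ (fun t => 0%:E * 0)); last first.
  move=> t _; rewrite /f/= indicE memNset ?mule0// => -[/= Bw _ _].
  by move/negP: wB; apply; exact: mem_set.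
by rewrite time_integralZ// mul0e.
Qed.

Lemma measurable_total_over : measurable_fun setT
  ((fun w => total_over k (fun t => h (Y w t)) (Order.min (S w) a)) \_ B).
Proof.
rewrite (_ : _ \_ _ = fun w => time_integral k (fun t => f (t, w))).
  exact: measurable_time_integral.
by apply/funext => w; exact: total_over_patch.
Qed.

(** Serves twice: with [B] full, [a] infinite and [c = 1] for [X] until its exit, and with [B] the
    event that a stage is reached and [a] the length of that stage. *)
Lemma integral_total_over (c : R) (F : R -> R) (rho : probability (borel E) R) :
  (0 <= c)%R -> measurable_fun setT F -> (forall t, (0 <= F t)%R) ->
  \int[rho]_x (h x)%:E \is a fin_num ->
  (forall t (A : set (borel E)), times R k t -> measurable A ->
     Q (B `&` [set w | t%:E < S w] `&` [set w | A (Y w t)]) = c%:E * ((F t)%:E * rho A)) ->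
  \int[Q]_(w in B) total_over k (fun t => h (Y w t)) (Order.min (S w) a) =
  c%:E * (\int[rho]_x (h x)%:E * time_integral k (fun t => if t%:E < a then (F t)%:E else 0)).
Proof.
move=> c0 mF F0 rfin QE.
rewrite integral_mkcond; under eq_integral do rewrite total_over_patch.
rewrite time_integral_swap//.
have r0 : 0 <= \int[rho]_x (h x)%:E by apply: integral_ge0 => x _; rewrite lee_fin.
pose u t := if t%:E < a then (F t)%:E else 0.
have key t : times R k t -> \int[Q]_w f (t, w) = c%:E * (\int[rho]_x (h x)%:E * u t).
  move=> kt; rewrite /u; have [ta|at_] := ltP t%:E a; last first.
    rewrite mule0 mule0; apply: integral0_eq => w _; rewrite /f/= indicE memNset ?mule0//.
    by move=> [_ _ /=]; rewrite ltNge at_.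
  have mD : measurable (B `&` [set w | t%:E < S w]).
    by apply: measurableI => //; exact: measurable_gt.
  transitivity (\int[Q]_(w in B `&` [set w | t%:E < S w]) (h (Y w t))%:E).
    rewrite [RHS]integral_mkcond epatch_indic; apply: eq_integral => w _.
    rewrite /f/=; congr (_ * _%:R%:E); congr nat_of_bool.
    by apply/idP/idP => /set_mem => [[h1 h2 _]|[h1 h2]]; apply: mem_set.
  rewrite (@integral_proportional_law _ _ _ (borel E) _ Q rho (fun w => Y w t) _ (c * F t)%R
    (fun x => (h x)%:E))//.
  - by rewrite EFinM -muleA [(F t)%:E * _]muleC.
  - by move=> _ A mA; rewrite setTI; exact: (measurable_process_at mY kt mA).
  - exact: mulr_ge0.
  - by move=> A mA; rewrite EFinM -muleA; exact: QE.
  - exact/measurable_EFinP.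
rewrite (eq_time_integral key).
have mu : measurable_fun setT u.
  apply: measurable_fun_ifT => //; last exact/measurable_EFinP.
  apply: (measurable_fun_bool true); rewrite setTI.
  rewrite [X in measurable X](_ : _ = [set t : R | t%:E < a]); last by [].
  rewrite -[X in measurable X]setTI.
  by apply: emeasurable_fun_infty_o => //; exact: measurable_EFin.
have u0 t : 0 <= u t by rewrite /u; case: ifP; rewrite ?lee_fin.
rewrite -(fineK rfin).
have r0' : (0 <= fine (\int[rho]_x (h x)%:E))%R by rewrite fine_ge0.
rewrite time_integralZ//; last 2 first.
- by apply: measurable_funeM; exact: measurable_funTS.
- by move=> t _; rewrite mule_ge0.
by rewrite time_integralZ//; exact: measurable_funTS.
Qed.

End integral_total_over.

(** * Decomposition of the integral of a multiplicative function along consecutive intervals *)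

Section renewal.
Context (R : realType) (k : time_kind) (F : R -> R).
Hypotheses (mF : measurable_fun setT F) (F0 : forall t, (0 <= F t)%R).
Hypothesis FD : forall s t, times R k s -> times R k t -> F (s + t) = (F s * F t)%R.

Let mif (x : R) : measurable_fun setT (fun t : R => if t%:E < x%:E then (F t)%:E else 0).
Proof.
apply: measurable_fun_ifT => //; last exact/measurable_EFinP.
apply: (measurable_fun_bool true); rewrite setTI.
rewrite [X in measurable X](_ : _ = `]-oo, x[%classic); first exact: measurable_itv.
by apply/seteqP; split=> t /=; rewrite in_itv.
Qed.

Lemma time_integral_renewal (s_ : nat -> R) (tau := fun n => (\sum_(i < n) s_ i)%R) :
  (forall n, times R k (s_ n)) -> (forall x, exists n, (x < tau n)%R) ->
  time_integral k (EFin \o F) =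
  \sum_(0 <= n <oo) ((F (tau n))%:E *
    time_integral k (fun t => if t%:E < (s_ n)%:E then (F t)%:E else 0)).
Proof.
move=> ks tau_oo.
have tauS n : tau n.+1 = (tau n + s_ n)%R by rewrite /tau big_ord_recr.
have tau0 : tau 0%N = 0%R by rewrite /tau big_ord0.
have ktau n : times R k (tau n).
  elim: n => [|n IH]; first by rewrite tau0; exact: times0.
  by rewrite tauS; exact: timesD.
have tau_nd m n : (m <= n)%N -> (tau m <= tau n)%R.
  move=> /subnK <-; elim: (n - m)%N => [//|j IH].
  by rewrite addSn tauS (le_trans IH)// lerDl (times_ge0 (ks _)).
pose u n t : \bar R := if (tau n <= t)%R then (if t%:E < (tau n.+1)%:E then (F t)%:E else 0) else 0.
have uF t : times R k t -> (F t)%:E = \sum_(0 <= n <oo) u n t.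
  move=> kt; apply/esym/cvg_lim => //.
  (* The first [n] terms add up to [F] restricted to times before [tau n], so the partial sums are
     constant once [tau n] exceeds [t]. *)
  have partial n : \sum_(0 <= i < n) u i t = if (t < tau n)%R then (F t)%:E else 0.
    elim: n => [|n IH]; first by rewrite big_geq// tau0 ltNge (times_ge0 kt).
    rewrite big_nat_recr//= IH /u lte_fin; have [tn|nt] := ltP t (tau n).
      by rewrite adde0 (lt_le_trans tn)// tau_nd.
    by rewrite add0e.
  have [N tN] := tau_oo t.
  apply: cvg_near_cst; exists N => //= n Nn.
  by rewrite partial (lt_le_trans tN)// tau_nd.
rewrite (eq_time_integral uF) time_integral_series.
- apply: eq_eseriesr => n _.
  rewrite time_integral_shift//.
  + rewrite -time_integralZ//.
    * apply: eq_time_integral => t kt; rewrite tauS !lte_fin ltrD2l.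
      by case: ifP; rewrite ?mule0// FD.
    * exact: measurable_funTS.
    * by move=> t _; case: ifP; rewrite ?lee_fin.
  + exact: measurable_funTS.
  + by move=> t _; case: ifP; rewrite ?lee_fin.
- move=> n; apply: measurable_funTS; apply: measurable_fun_ifT => //.
  apply: (measurable_fun_bool true); rewrite setTI.
  rewrite [X in measurable X](_ : _ = `[tau n, +oo[%classic); first exact: measurable_itv.
  by apply/seteqP; split=> t /=; rewrite in_itv/= andbT.
- by move=> n t _; rewrite /u; do 2 case: ifP => //; rewrite ?lee_fin.
Qed.

(** With all intervals of length [n], the first contributes at most [n] and the one of index [m] is
    scaled by at most [q ^+ m]; the sum is bounded by a convergent geometric series. *)
Lemma time_integral_fin (n : nat) : (forall t, (F t <= 1)%R) -> (0 < n)%N ->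
  (F n%:R < 1)%R -> time_integral k (EFin \o F) \is a fin_num.
Proof.
move=> F1 n0 Fn1; set q := F n%:R in Fn1.
pose J := time_integral k (fun t => if t%:E < (n%:R : R)%:E then (F t)%:E else 0).
have kn : times R k n%:R by exact: times_natr.
rewrite ge0_fin_numE; last by apply: time_integral_ge0 => t _; rewrite lee_fin.
have tauE m : (\sum_(i < m) n%:R)%R = (m * n)%:R :> R.
  by rewrite sumr_const card_ord -mulrnA mulnC.
rewrite (@time_integral_renewal (fun=> n%:R%R))//; last first.
  move=> x; exists (Num.trunc `|x|).+1; rewrite tauE.
  have /truncn_itv/andP[_ h] : (0 <= `|x|)%R by [].
  rewrite (le_lt_trans (ler_norm x))// (lt_le_trans h)// ler_nat.
  by rewrite leq_pmulr.
rewrite -/J.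
have J0 : 0 <= J by apply: time_integral_ge0 => t _; case: ifP; rewrite ?lee_fin.
have Jn : J <= n%:R%:E.
  rewrite -(time_integral_lt_natr R k) /J; apply: le_time_integral.
  - exact: measurable_funTS.
  - apply: measurable_funTS; apply: measurable_fun_ifT => //.
    apply: (measurable_fun_bool true); rewrite setTI.
    rewrite [X in measurable X](_ : _ = `]-oo, n%:R[%classic); first exact: measurable_itv.
    by apply/seteqP; split=> t /=; rewrite in_itv.
  - by move=> t _; case: ifP; rewrite ?lee_fin.
  - by move=> t _; rewrite lte_fin; case: ifP => // _; rewrite lee_fin.
have Fq m : (F (m * n)%:R <= q ^+ m)%R.
  elim: m => [|m IH]; first by rewrite expr0.
  rewrite mulSn natrD FD//; last exact: times_natr.
  by rewrite exprS ler_wpM2l// F0.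
apply: (@le_lt_trans _ _ (\sum_(0 <= m <oo) (n%:R%:E * (q ^+ m)%:E))).
  apply: lee_nneseries => m _; first by move=> _; rewrite mule_ge0// lee_fin.
  by rewrite tauE muleC; apply: lee_pmul => //; rewrite lee_fin.
rewrite nneseriesZl; last by move=> m _; rewrite lee_fin exprn_ge0// F0.
rewrite (_ : \sum_(0 <= m <oo) (q ^+ m)%:E = ((1 - q)^-1)%:E) ?ltry//.
apply/cvg_lim => //; rewrite (_ : (fun m => _) = EFin \o series (geometric 1 q)).
  apply: cvg_EFin; first exact: nearW.
  have := @cvg_geometric_series R 1 q; rewrite div1r; apply.
  by rewrite ger0_norm// F0.
apply/funext => m /=; rewrite sumEFin /series/=; congr (_%:E).
by apply: eq_bigr => i _; rewrite mul1r.
Qed.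

End renewal.

Lemma nneseries_fin_term (R : realType) (u : nat -> \bar R) (P : pred nat) N :
  (forall n, P n -> 0 <= u n) -> \sum_(N <= n <oo | P n) u n < +oo ->
  forall n, (N <= n)%N -> P n -> u n \is a fin_num.
Proof.
move=> u0 uoo n Nn Pn; rewrite ge0_fin_numE ?u0//; apply: le_lt_trans uoo.
apply: (@le_trans _ _ (\sum_(N <= i < n.+1 | P i) u i)).
  by rewrite big_mkcond big_nat_recr//= Pn leeDr// sume_ge0// => i _; case: ifP => // /u0.
by apply: nneseries_lim_ge => i _; exact: u0.
Qed.

Lemma eseriesB (R : realType) (u v : nat -> \bar R) (P : pred nat) N :
  (forall n, P n -> 0 <= u n) -> (forall n, P n -> 0 <= v n) ->
  \sum_(N <= n <oo | P n) u n < +oo -> \sum_(N <= n <oo | P n) v n < +oo ->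
  \sum_(N <= n <oo | P n) (u n - v n) =
  \sum_(N <= n <oo | P n) u n - \sum_(N <= n <oo | P n) v n.
Proof.
move=> u0 v0 uoo voo.
have cvg (w : nat -> \bar R) : (forall n, P n -> 0 <= w n) ->
    (fun n => \sum_(N <= i < n | P i) w i) @ \oo --> \sum_(N <= i <oo | P i) w i.
  by move=> w0; apply: is_cvg_nneseries => n _; exact: w0.
apply/cvg_lim => //.
rewrite (_ : (fun n => _) = fun n => \sum_(N <= i < n | P i) u i - \sum_(N <= i < n | P i) v i).
  apply: cvgeB; [|exact: cvg..].
  rewrite fin_num_adde_defr// ge0_fin_numE//.
  by apply: nneseries_ge0 => n _; exact: u0.
apply/funext => n; rewrite big_split/=; congr (_ + _).
rewrite big_seq_cond fin_num_sumeN -?big_seq_cond// => i.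
rewrite mem_index_iota => /andP[/andP[Ni _] Pi].
exact: nneseries_fin_term v0 voo _ Ni Pi.
Qed.

Lemma total_overB (R : realType) (k : time_kind) (h1 h2 : R -> R) (tau : \bar R) :
  measurable_fun (times R k) h1 -> measurable_fun (times R k) h2 ->
  (forall t, 0 <= h1 t)%R -> (forall t, 0 <= h2 t)%R ->
  total_over k h1 tau < +oo -> total_over k h2 tau < +oo ->
  total_over k (fun t => h1 t - h2 t)%R tau = total_over k h1 tau - total_over k h2 tau.
Proof.
rewrite /total_over; move: (measurable_times (R := R) k); rewrite /times.
case: k => mD mh1 mh2 h10 h20.
  by move=> oo1 oo2; rewrite -eseriesB// => n _; rewrite lee_fin.
have mDt : measurable [set t : R | (0 <= t)%R /\ t%:E < tau].
  rewrite (_ : [set _ | _] = [set t | (0 <= t)%R] `&` [set t | t%:E < tau])//.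
  apply: measurableI => //; rewrite -[X in measurable X]setTI.
  by apply: emeasurable_fun_infty_o => //; exact: measurable_EFin.
have int (h : R -> R) : measurable_fun [set t : R | (0 <= t)%R] h -> (forall t, 0 <= h t)%R ->
    \int[@lebesgue_measure R]_(t in [set t | (0 <= t)%R /\ t%:E < tau]) (h t)%:E < +oo ->
    (@lebesgue_measure R).-integrable [set t | (0 <= t)%R /\ t%:E < tau] (EFin \o h).
  move=> mh h0 hoo; apply/integrableP; split.
    by apply/measurable_EFinP; apply: measurable_funS mh => // t [].
  by under eq_integral do rewrite /= ger0_norm//.
move=> oo1 oo2; rewrite -integralB//; [exact: int..].
Qed.

(** * Expected rewards *)

(** Integrability makes [f1] and [f2] finite almost everywhere, so the identity is asked only where
    no difference of infinities occurs. Measurability of [f] is not assumed, which suits integrands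
    built on [pos_exit_time]. *)
Lemma integral_null_diff d (T : measurableType d) (R : realType)
    (mu : {measure set T -> \bar R}) (N : set T) (f f1 f2 : T -> \bar R) :
  measurable N -> mu N = 0 ->
  measurable_fun setT f1 -> measurable_fun setT f2 ->
  (forall x, 0 <= f1 x) -> (forall x, 0 <= f2 x) ->
  \int[mu]_x f1 x < +oo -> \int[mu]_x f2 x < +oo ->
  (forall x, ~ N x -> f1 x < +oo -> f2 x < +oo -> f x = f1 x - f2 x) ->
  \int[mu]_x f x = \int[mu]_x f1 x - \int[mu]_x f2 x.
Proof.
move=> mN N0 mf1 mf2 f10 f20 f1oo f2oo fE.
have int (u : T -> \bar R) : measurable_fun setT u -> (forall x, 0 <= u x) ->
    \int[mu]_x u x < +oo -> mu.-integrable setT u.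
  move=> mu' u0 uoo; apply/integrableP; split=> //.
  by under eq_integral do rewrite gee0_abs//.
have [N1 [mN1 N10 N1E]] := integrable_ae measurableT (int _ mf1 f10 f1oo).
have [N2 [mN2 N20 N2E]] := integrable_ae measurableT (int _ mf2 f20 f2oo).
rewrite -integralB//; [|exact: int..].
apply: (@integral_null_set _ _ _ mu (N `|` (N1 `|` N2))).
- by apply: measurableU => //; exact: measurableU.
- by apply: null_set_setU => //; [exact: measurableU|exact: null_set_setU].
- move=> x /not_orP[nN /not_orP[nN1 nN2]]; apply: fE => //.
    rewrite -ge0_fin_numE//; apply: contrapT => h; apply: nN1; apply: N1E => /=.
    by move=> /(_ I).
  rewrite -ge0_fin_numE//; apply: contrapT => h; apply: nN2; apply: N2E => /=.
  by move=> /(_ I).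
Qed.

Lemma total_over_ge0 (R : realType) (k : time_kind) (h : R -> R) (tau : \bar R) :
  (forall t, 0 <= h t)%R -> 0 <= total_over k h tau.
Proof.
move=> h0; rewrite total_overE; apply: time_integral_ge0 => t _.
by case: ifP; rewrite ?lee_fin.
Qed.

(** Links the summation bound [m <= L] to survival of the earlier stages. If no stage fails, the
    infimum is [+oo] and all stages count. *)
Lemma le_first_exit d (W : measurableType d) (R : realType) (S : nat -> W -> \bar R)
    (t_ : nat -> R) (m : nat) (w : W) :
  (m%:R%:E <= first_exit S t_ w) <-> (forall j, (1 <= j < m)%N -> (t_ j)%:E < S j w).
Proof.
split=> [le j /andP[j1 jm]|h].
  rewrite ltNge; apply/negP => Sj; move: le; apply/negP; rewrite -ltNge.
  apply: (@le_lt_trans _ _ j%:R%:E); last by rewrite lte_fin ltr_nat.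
  by apply: ereal_inf_lbound; exists j.
apply/ereal_infP => _ [j [j1 Sj] <-]; rewrite lee_fin ler_nat leqNgt.
by apply/negP => jm; have := h j; rewrite j1 jm => /(_ isT); rewrite ltNge Sj.
Qed.

Section restarted_process.
Context (R : realType) (k : time_kind) (E : pseudoPMetricType R)
  d (W : measurableType d).
Variables (X : {mfun W >-> path_space k E}) (P : R.-pker (borel E) ~> W).
Hypothesis X_markov : cadlag_strong_markov_process X P.
Variable U : set E.
Hypothesis U_open : open U.
Variable T : {mfun W >-> \bar R}.
Hypothesis T_exit : forall w, T w = exit_time k U (X w).
Variable rho : probability (borel E) R.
Hypothesis rho_qsd : is_qsd X P U T rho.
Hypothesis T_finite : {ae mixture P rho, forall w, T w < +oo}.

Local Notation surv := (survival P T rho).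

Let surv_ge0 t : (0 <= surv t)%R.
Proof. exact: survival_ge0. Qed.

Let survD s t : times R k s -> times R k t -> surv (s + t) = (surv s * surv t)%R.
Proof. exact: (survivalD X_markov U_open T_exit rho_qsd). Qed.

Let msurv : measurable_fun setT surv.
Proof.
apply: nonincreasing_measurable => // s t st.
rewrite -lee_fin !survivalE; apply: le_measure; rewrite ?inE.
- by apply: measurable_gt; exact: measurable_funPT.
- by apply: measurable_gt; exact: measurable_funPT.
- by move=> w /=; apply: le_lt_trans; rewrite lee_fin.
Qed.

(** By multiplicativity [surv 0] is its own square, and it is positive. *)
Let surv0 : surv 0 = 1%R.
Proof.
have s0 : (0 < surv 0)%R by apply: (survival_gt0 U_open rho_qsd); exact: times0.
have h := survD (times0 R k) (times0 R k); rewrite addr0 in h.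
by apply: (mulfI (lt0r_neq0 s0)); rewrite mulr1 -h.
Qed.

Let surv_lt1 : exists2 n : nat, (0 < n)%N & (surv n%:R < 1)%R.
Proof.
apply: contrapT => h.
have s1 (n : nat) : surv n.+1%:R = 1%R.
  apply/eqP; rewrite eq_le survival_le1/= leNgt; apply/negP => lt.
  by apply: h; exists n.+1.
have : {ae mixture P rho, forall w, forall n : nat, n.+1%:R%:E < T w}.
  apply/ae_foralln => n.
  have mA : measurable [set w | n.+1%:R%:E < T w].
    by apply: measurable_gt; exact: measurable_funPT.
  exists (~` [set w | n.+1%:R%:E < T w]); split=> //; first exact: measurableC.
  apply: etrans (probability_setC (mixture P rho) mA) _.
  have hE := esym (survivalE P T rho n.+1%:R); rewrite s1 in hE.
  by apply: etrans (congr1 (fun z => 1 - z) hE) _; exact: subee.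
move=> alive_oo.
(* Exceeding every integer contradicts finiteness, so the whole space would be null under a
   probability. *)
have [N [mN N0 NT]] : {ae mixture P rho, forall w : W, False}.
  apply: filterS2 alive_oo T_finite => w wn woo.
  have := wn (Num.trunc (fine (T w))).
  have [T0|T0] := leP 0 (T w); last first.
    by apply/negP; rewrite -leNgt (le_trans (ltW T0))// lee_fin.
  rewrite -[X in _ < X]fineK ?ge0_fin_numE// lte_fin ltNge.
  have /truncn_itv/andP[_ /ltW ->] : (0 <= fine (T w))%R by rewrite fine_ge0.
  by [].
have NE : N = setT by apply/seteqP; split=> // w _; exact: NT.
have := oner_neq0 R; move: N0; rewrite NE probability_setT => -[->].
by rewrite eqxx.
Qed.

Local Notation lifetime := (time_integral k (EFin \o surv)).

Lemma lifetime_fin : lifetime \is a fin_num.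
Proof.
have [n n0 n1] := surv_lt1.
apply: (time_integral_fin msurv surv_ge0 survD _ n0 n1) => t.
exact: survival_le1.
Qed.

Section nonnegative_reward.
Variable h : borel E -> R.
Hypotheses (mh : measurable_fun setT h) (h0 : forall x, (0 <= h x)%R).
Hypothesis h_fin : \int[rho]_x (h x)%:E \is a fin_num.

Lemma measurable_reward_until_exit :
  measurable_fun setT (fun w => total_over k (fun t => h (X w t)) (T w)).
Proof.
have [_ X_cadlag _ _] := X_markov.
have := measurable_total_over +oo (measurable_funPT X) X_cadlag (measurable_funPT T)
  measurableT mh h0.
rewrite patch_setT; under eq_fun do rewrite min_l ?leey//; exact.
Qed.

Lemma reward_until_exit :
  \int[mixture P rho]_w total_over k (fun t => h (X w t)) (T w) =
  \int[rho]_x (h x)%:E * lifetime.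
Proof.
have [_ X_cadlag _ _] := X_markov.
have := @integral_total_over _ _ _ _ _ (mixture P rho) X T setT +oo (measurable_funPT X)
  X_cadlag (measurable_funPT T) measurableT h mh h0 1 surv rho ler01 msurv surv_ge0 h_fin.
rewrite mul1e; under eq_integral do rewrite min_l ?leey//.
move=> -> => [|t A kt mA].
  by congr (_ * _); apply: eq_time_integral => t _; rewrite ltry.
by rewrite setTI mul1e; exact: (qsd_law X_markov U_open T_exit rho_qsd).
Qed.

Section copies.
Context d' (W' : measurableType d') (Q : probability W' R)
  (X_ : nat -> {mfun W' >-> path_space k E}) (T_ : nat -> {mfun W' >-> \bar R}).
Hypothesis X_cadlag : forall m w, (1 <= m)%N -> cadlag k (X_ m w : R -> E).
Hypothesis XT_copy : forall m, (1 <= m)%N -> is_copy X P T Q (X_ m) (T_ m).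
Variable t_ : nat -> R.
Hypothesis t_time : forall m, (1 <= m)%N -> times R k (t_ m) /\ (0 < t_ m)%R.
Hypothesis t_sum : \sum_(1 <= m <oo) (t_ m)%:E = +oo.
Hypothesis hyp_a : forall m, (1 <= m)%N ->
  cond_independent Q
    (preimage_set_system setT (fun w => X_ m w 0%R : borel E) measurable)
    (preimage_set_system setT (X_ m) measurable)
    (past X_ m).
Hypothesis hyp_b1 : forall A : set (borel E), measurable A ->
  Q [set w | A (X_ 1%N w 0%R)] = rho A.
Hypothesis hyp_b : forall m, (2 <= m)%N -> forall A : set (borel E), measurable A ->
  cond_prob Q
    [set w | forall j, (1 <= j < m)%N -> (t_ j)%:E < T_ j w]
    [set w | A (X_ m w 0%R)] = fine (rho A).

Local Notation reward m w :=
  (total_over k (fun t => h (X_ m w t)) (Order.min (T_ m w) (t_ m)%:E)).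

(** Stages are numbered from [1] and intervals from [0]: stage [n + 1] corresponds to the interval
    from [tau n] to [tau n.+1]. *)
Let tau n : R := (\sum_(i < n) t_ i.+1)%R.

Let tau_oo x : exists n, (x < tau n)%R.
Proof.
apply: contrapT => h'.
have le n : (tau n <= x)%R by rewrite leNgt; apply/negP => lt; apply: h'; exists n.
have : \sum_(1 <= m <oo) (t_ m)%:E <= x%:E.
  apply: lime_le.
    by apply: is_cvg_nneseries => n n1 _; rewrite lee_fin ltW// (t_time n1).2.
  apply: nearW => -[|n].
    by rewrite big_geq// lee_fin; have := le 0%N; rewrite /tau big_ord0.
  by rewrite big_add1/= big_mkord sumEFin lee_fin; exact: le.
by rewrite t_sum.
Qed.

Let alive_surv n : alive_prob Q T_ t_ n.+1 = surv (tau n).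
Proof.
have kt n' : times R k (t_ n'.+1) by have [] := t_time (ltn0Sn n').
have ktau n' : times R k (tau n').
  elim: n' => [|n' IH]; first by rewrite /tau big_ord0; exact: times0.
  by rewrite /tau big_ord_recr; exact: timesD.
elim: n => [|n IH].
  by rewrite /alive_prob alive1 probability_setT /tau big_ord0 surv0.
rewrite (alive_probS X_markov U_open T_exit XT_copy hyp_a hyp_b1 hyp_b)// IH.
by rewrite -survD// /tau big_ord_recr.
Qed.

(** Trades the random number of summands for indicators of reached stages, so that expectation and
    series can be exchanged. *)
Let reward_series w :
  \sum_(1 <= m <oo | m%:R%:E <= first_exit T_ t_ w) reward m w =
  \sum_(0 <= n <oo) ((fun w => reward n.+1 w) \_ (alive T_ t_ n.+1)) w.
Proof.
rewrite eseries_mkcond -nneseries_addn; last first.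
  by move=> m; case: ifP => // _; exact: total_over_ge0.
apply: eq_eseriesr => n _; rewrite addn1 patchE.
have [le|nle] := boolP (n.+1%:R%:E <= first_exit T_ t_ w).
  rewrite mem_set//; exact: (le_first_exit (fun m => T_ m) t_ _ w).1.
rewrite memNset// => aw; move/negP: nle; apply.
exact: (le_first_exit (fun m => T_ m) t_ _ w).2.
Qed.

Let reward_patch n : measurable_fun setT ((fun w => reward n.+1 w) \_ (alive T_ t_ n.+1)) /\
  forall w, 0 <= ((fun w => reward n.+1 w) \_ (alive T_ t_ n.+1)) w.
Proof.
have cX w : cadlag k (X_ n.+1 w : R -> E) by exact: X_cadlag.
split=> [|w].
  exact: (measurable_total_over (t_ n.+1)%:E (measurable_funPT (X_ n.+1)) cX
    (measurable_funPT (T_ n.+1)) (measurable_alive T_ t_ (ltn0Sn n)) mh h0).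
by rewrite patchE; case: ifP => // _; exact: total_over_ge0.
Qed.

Lemma measurable_reward_restarted : measurable_fun setT
  (fun w => \sum_(1 <= m <oo | m%:R%:E <= first_exit T_ t_ w) reward m w).
Proof.
rewrite (funext reward_series).
by apply: (@ge0_emeasurable_sum _ _ _ _ _ xpredT) => n; have [] := reward_patch n.
Qed.

Lemma reward_restarted :
  \int[Q]_w (\sum_(1 <= m <oo | m%:R%:E <= first_exit T_ t_ w) reward m w) =
  \int[rho]_x (h x)%:E * lifetime.
Proof.
under eq_integral do rewrite reward_series.
rewrite integral_nneseries//; last 2 first.
- by move=> n; have [] := reward_patch n.
- by move=> n w _; have [_] := reward_patch n; apply.
have kt n : times R k (t_ n.+1) by have [] := t_time (ltn0Sn n).
rewrite (time_integral_renewal msurv surv_ge0 survD kt tau_oo).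
rewrite -(fineK h_fin) -nneseriesZl; last first.
  move=> n _; rewrite mule_ge0 ?lee_fin//; apply: time_integral_ge0 => t _.
  by case: ifP; rewrite ?lee_fin.
apply: eq_eseriesr => n _; rewrite -integral_mkcond fineK//.
rewrite (@integral_total_over _ _ _ _ _ Q (X_ n.+1) (T_ n.+1) (alive T_ t_ n.+1) (t_ n.+1)%:E
  (measurable_funPT _) _ (measurable_funPT _) (measurable_alive T_ t_ (ltn0Sn n)) h mh h0
  (surv (tau n)) surv rho)//.
- by rewrite muleCA.
- by move=> w; exact: X_cadlag.
- move=> t A kt' mA; rewrite -alive_surv.
  rewrite -(qsd_law X_markov U_open T_exit rho_qsd kt' mA).
  exact: (alive_survival X_markov U_open T_exit XT_copy hyp_a hyp_b1 hyp_b _ (ltn0Sn n)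
    (measurable_coordinate kt' mA)).
Qed.

End copies.

End nonnegative_reward.

End restarted_process.

Lemma measurable_sample_path (R : realType) (k : time_kind) (E : pseudoPMetricType R)
    d (W : measurableType d) (Y : W -> path_space k E) (w : W) :
  measurable_fun setT Y -> (forall w, cadlag k (Y w : R -> E)) ->
  measurable_fun (times R k) (fun t => Y w t : borel E).
Proof.
move=> mY cY.
have mD : measurable (times R k `*` [set: W]) by apply: measurableX => //; exact: measurable_times.
have mp : measurable_fun (times R k) (fun t : R => (t, w)).
  by apply: measurable_funTS; exact: measurable_pair2.
apply: (measurable_comp mD _ (measurable_process mY cY) mp).
by move=> _ [t kt <-]; split.
Qed.

Theorem theorem5p3 (R : realType) (k : time_kind)
    (E : pseudoPMetricType R) (E_hausdorff : hausdorff_space E)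
    (E_standard : standard_borel E)
    (* the Markov process, with an arbitrary initial distribution *)
    (d : measure_display) (W : measurableType d)
    (X : {mfun W >-> path_space k E}) (P : R.-pker (borel E) ~> W)
    (X_markov : cadlag_strong_markov_process X P)
    (* its exit time from U and its QSD in U *)
    (U : set E) (U_open : open U)
    (T : {mfun W >-> \bar R}) (T_exit : forall w, T w = exit_time k U (X w))
    (rho : probability (borel E) R) (rho_qsd : is_the_qsd X P U T rho)
    (T_finite : {ae mixture P rho, forall w, T w < +oo})
    (* the copies and the deterministic times *)
    (d' : measure_display) (W' : measurableType d') (Q : probability W' R)
    (X_ : nat -> {mfun W' >-> path_space k E}) (T_ : nat -> {mfun W' >-> \bar R})
    (X_cadlag : forall m w, (1 <= m)%N -> cadlag k (X_ m w : R -> E))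
    (XT_copy : forall m, (1 <= m)%N -> is_copy X P T Q (X_ m) (T_ m))
    (t_ : nat -> R)
    (t_time : forall m, (1 <= m)%N -> times R k (t_ m) /\ (0 < t_ m)%R)
    (t_sum : \sum_(1 <= m <oo) (t_ m)%:E = +oo)
    (hyp_a : forall m, (1 <= m)%N ->
       cond_independent Q
         (preimage_set_system setT (fun w => X_ m w 0%R : borel E) measurable)
         (preimage_set_system setT (X_ m) measurable)
         (past X_ m))
    (hyp_b1 : forall A : set (borel E), measurable A ->
       Q [set w | A (X_ 1%N w 0%R)] = rho A)
    (hyp_b : forall m, (2 <= m)%N -> forall A : set (borel E), measurable A ->
       cond_prob Q
         [set w | forall j, (1 <= j < m)%N -> (t_ j)%:E < T_ j w]
         [set w | A (X_ m w 0%R)] = fine (rho A))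
    (g : borel E -> R) (g_meas : measurable_fun setT g)
    (g_bounded : exists M : R, forall x, (`|g x| <= M)%R) :
  \int[Q]_w (\sum_(1 <= m <oo | (m%:R%:E <= first_exit T_ t_ w))
     total_over k (fun t => g (X_ m w t)) (Order.min (T_ m w) (t_ m)%:E)) =
  \int[mixture P rho]_w
     total_over k (fun t => g (X w t)) (pos_exit_time k U (X w)).
Proof.
have [M gM] := g_bounded.
have M0 : (0 <= M)%R by apply: le_trans (gM point).
(* The signed reward is a difference of two nonnegative bounded ones, the second of them constant;
   evaluating the bound at [point] gave [0 <= M]. *)
pose h1 x := (g x + M)%R; pose h2 (x : borel E) := M.
have mh1 : measurable_fun setT h1 by exact: measurable_funD.
have mh2 : measurable_fun setT h2 by exact: measurable_cst.
have h10 x : (0 <= h1 x)%R by have := gM x; rewrite ler_norml -lerBlDr sub0r => /andP[].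
have h20 x : (0 <= h2 x)%R by [].
have gE x : g x = (h1 x - h2 x)%R by rewrite addrK.
have fin (h : borel E -> R) : measurable_fun setT h -> (forall x, 0 <= h x)%R ->
    (forall x, h x <= M + M)%R -> \int[rho]_x (h x)%:E \is a fin_num.
  move=> mh h0 hM; rewrite ge0_fin_numE; last by apply: integral_ge0 => x _; rewrite lee_fin.
  apply: (@le_lt_trans _ _ (\int[rho]_x (cst (M + M)%:E x))).
    apply: ge0_le_integral => //; first by move=> x _; rewrite lee_fin.
      exact/measurable_EFinP.
    by move=> x _; rewrite lee_fin.
  rewrite integral_cst// (_ : _ * _ = (M + M)%:E) ?ltry//.
  by rewrite -[RHS]mule1; congr (_ * _); exact: probability_setT.
have fin1 : \int[rho]_x (h1 x)%:E \is a fin_num.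
  by apply: fin => // x; rewrite lerD2r (le_trans (ler_norm _)).
have fin2 : \int[rho]_x (h2 x)%:E \is a fin_num by apply: fin => // x; rewrite lerDl.
have [_ X_cadlag' _ _] := X_markov.
have [qsd _ _] := rho_qsd.
have mU : measurable (U : set (borel E)) by exact: sub_sigma_algebra.
have diff d0 (W0 : measurableType d0) (Y : W0 -> path_space k E) (tau : \bar R) w :
    measurable_fun setT Y -> (forall w, cadlag k (Y w : R -> E)) ->
    total_over k (fun t => h1 (Y w t)) tau < +oo -> total_over k (fun t => h2 (Y w t)) tau < +oo ->
    total_over k (fun t => g (Y w t)) tau =
    total_over k (fun t => h1 (Y w t)) tau - total_over k (fun t => h2 (Y w t)) tau.
  move=> mY cY oo1 oo2; rewrite -total_overB//.
  - by congr total_over; apply/funext => t; exact: gE.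
  - exact: measurableT_comp mh1 (measurable_sample_path w mY cY).
have lif := lifetime_fin X_markov U_open T_exit qsd T_finite.
have lty h : \int[rho]_x (h x)%:E \is a fin_num ->
    \int[rho]_x (h x)%:E * time_integral k (EFin \o survival P T rho) < +oo.
  by move=> hfin; rewrite ltey_eq fin_numM.
have r1 := reward_until_exit X_markov U_open T_exit qsd mh1 h10 fin1.
have r2 := reward_until_exit X_markov U_open T_exit qsd mh2 h20 fin2.
have s1 := reward_restarted X_markov U_open T_exit qsd mh1 h10 fin1 X_cadlag XT_copy
  t_time t_sum hyp_a hyp_b1 hyp_b.
have s2 := reward_restarted X_markov U_open T_exit qsd mh2 h20 fin2 X_cadlag XT_copy
  t_time t_sum hyp_a hyp_b1 hyp_b.
transitivity (\int[rho]_x (h1 x)%:E * time_integral k (EFin \o survival P T rho) -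
              \int[rho]_x (h2 x)%:E * time_integral k (EFin \o survival P T rho)).
  rewrite -s1 -s2; apply: (@integral_null_diff _ _ _ Q set0) => //.
  - exact: measurable_reward_restarted.
  - exact: measurable_reward_restarted.
  - by move=> w; apply: nneseries_ge0 => m _ _; exact: total_over_ge0.
  - by move=> w; apply: nneseries_ge0 => m _ _; exact: total_over_ge0.
  - by rewrite s1; exact: lty.
  - by rewrite s2; exact: lty.
  (* The lower bound [1] enters the summation predicate, so that it is at hand for each term. A
     finite series of nonnegative terms has finite terms, hence the splitting of [g] applies stage
     by stage. *)
  move=> w _; rewrite !(eseries_cond _ _ 1) => oo1 oo2.
  rewrite -eseriesB//; [|by move=> *; exact: total_over_ge0..].
  apply: eq_eseriesr => m Pm; have /andP[_ m1] := Pm.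
  apply: diff; [exact: measurable_funPT|by move=> w'; exact: X_cadlag|..].
  - have := nneseries_fin_term _ oo1 (leq0n m) Pm; rewrite ge0_fin_numE ?total_over_ge0//.
    by apply => n _; exact: total_over_ge0.
  - have := nneseries_fin_term _ oo2 (leq0n m) Pm; rewrite ge0_fin_numE ?total_over_ge0//.
    by apply => n _; exact: total_over_ge0.
apply/esym; rewrite -r1 -r2.
(* [pos_exit_time] ignores time [0] and can differ from [T] only for paths starting outside [U], a
   null event since [rho U = 1]. *)
apply: (@integral_null_diff _ _ _ (mixture P rho) [set w | (~` U) (X w 0%R)]).
- by apply: (measurable_process_at (measurable_funPT X) (times0 R k)); exact: measurableC.
- have X_start : starts_at_point X P by case: X_markov.
  apply: etrans (mixture_start X_start rho (measurableC mU)) _.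
  by rewrite probability_setC// qsd.1 subee.
- exact: (measurable_reward_until_exit X_markov T mh1 h10).
- exact: (measurable_reward_until_exit X_markov T mh2 h20).
- by move=> w; exact: total_over_ge0.
- by move=> w; exact: total_over_ge0.
- by rewrite r1; exact: lty.
- by rewrite r2; exact: lty.
- move=> w /contrapT Uw oo1 oo2; rewrite pos_exit_timeE// -T_exit.
  by apply: diff => //; exact: measurable_funPT.
Qed.
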